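(* Let $n\ge 2$ and let $\boldsymbol{\alpha}=(\alpha_1,\ldots,\alpha_n)\in\mathbb{Z}^n$ with $\alpha_i>-1$ for $i=1,\ldots,n$. Then a quotient module $\mathcal{Q}$ of $L^2_{a,\boldsymbol{\alpha}}(\mathbb{D}^n)$ is doubly commuting if and only if $\mathcal{Q}=\mathcal{Q}_1\otimes\cdots\otimes\mathcal{Q}_n$ for some quotient modules $\mathcal{Q}_i$ of $L^2_{a,\alpha_i}(\mathbb{D})$, $i=1,\ldots,n$.
   Context: For $\alpha>-1$, the weighted Bergman space on the open unit disc $\mathbb{D}$ is $$L^2_{a,\alpha}(\mathbb{D})=\Big\{f\ \text{holomorphic on}\ \mathbb{D}:\ \int_{\mathbb{D}}|f(z)|^2\,dA_\alpha(z)<\infty\Big\},\quad dA_\alpha(z)=(\alpha+1)(1-|z|^2)^\alpha\,dA(z),$$ where $dA$ is normalized area measure on $\mathbb{D}$; its reproducing kernel is $K_\alpha(z,w)=(1-z\bar w)^{-(\alpha+2)}$. The weighted Bergman space $L^2_{a,\boldsymbol{\alpha}}(\mathbb{D}^n)$ is the reproducing kernel Hilbert space of holomorphic functions on $\mathbb{D}^n$ with kernel $\prod_{i=1}^n(1-z_i\bar w_i)^{-(\alpha_i+2)}$; it is identified with the Hilbert space tensor product $L^2_{a,\alpha_1}(\mathbb{D})\otimes\cdots\otimes L^2_{a,\alpha_n}(\mathbb{D})$. Let $M_{z_i}$ denote multiplication by the coordinate $z_i$ (and $M_z$ multiplication by $z$ in one variable). A closed subspace is a submodule if it is invariant under all coordinate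 multiplication operators; a closed subspace $\mathcal{Q}$ is a quotient module if $\mathcal{Q}^\perp$ is a submodule. For a quotient module $\mathcal{Q}$ put $C_{z_i}=P_{\mathcal{Q}}M_{z_i}|_{\mathcal{Q}}$, where $P_{\mathcal{Q}}$ is the orthogonal projection onto $\mathcal{Q}$; $\mathcal{Q}$ is doubly commuting if $C_{z_i}C_{z_j}^*=C_{z_j}^*C_{z_i}$ for all $1\le i<j\le n$. *)

(* Defs.v *)
From HB Require Import structures.
From mathcomp Require Import all_boot all_order all_algebra.
From mathcomp Require Import all_classical all_reals all_analysis.
From mathcomp Require Import complex.

Set Implicit Arguments.
Unset Strict Implicit.
Unset Printing Implicit Defensive.
Import Order.TTheory GRing.Theory Num.Theory.
Import numFieldNormedType.Exports.
Local Open Scope classical_set_scope.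
Local Open Scope complex_scope.
Local Open Scope ring_scope.

(* The inner product is linear in the first argument.  The values of [inner]
   outside [carrier] are unspecified and never used. *)
Record hilbert_fun_space (R : realType) (X : Type) := HilbertFunSpace {
  carrier : set (X -> R[i]);
  inner : (X -> R[i]) -> (X -> R[i]) -> R[i];
  carrier0 : carrier (fun=> 0);
  carrier_lin : forall (a : R[i]) f g, carrier f -> carrier g ->
    carrier (fun x => a * f x + g x);
  inner_lin : forall (a : R[i]) f g h, carrier f -> carrier g -> carrier h ->
    inner (fun x => a * f x + g x) h = a * inner f h + inner g h;
  inner_conj : forall f g, carrier f -> carrier g ->
    inner g f = (inner f g)^*;
  inner_ge0 : forall f, carrier f -> 0 <= inner f f;
  inner_def : forall f, carrier f -> inner f f = 0 -> f = (fun=> 0);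
  hilbert_complete : forall u : nat -> X -> R[i],
    (forall n, carrier (u n)) ->
    (forall e : R, 0 < e -> exists N : nat, forall m n,
       (N <= m)%N -> (N <= n)%N ->
       Num.sqrt (complex.Re (inner (fun x => u m x - u n x)
                                   (fun x => u m x - u n x))) < e) ->
    exists2 f, carrier f & forall e : R, 0 < e -> exists N : nat, forall n,
       (N <= n)%N ->
       Num.sqrt (complex.Re (inner (fun x => u n x - f x)
                                   (fun x => u n x - f x))) < e }.

Section HilbertFunSpace.
Variables (R : realType) (X : Type) (H : hilbert_fun_space R X).
Implicit Types (S Q : set (X -> R[i])) (f g h : X -> R[i]).

Definition hnorm f : R := Num.sqrt (complex.Re (inner H f f)).

Definition reproducing_kernel (K : X -> X -> R[i]) : Prop :=
  (forall w, carrier H (fun z => K z w)) /\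
  (forall f w, carrier H f -> f w = inner H f (fun z => K z w)).

Definition hclosure S : set (X -> R[i]) :=
  [set f | carrier H f /\ forall e : R, 0 < e ->
     exists g, [/\ carrier H g, S g & hnorm (fun x => f x - g x) < e]].

Definition closed_subspace S : Prop :=
  [/\ S `<=` carrier H, S (fun=> 0),
      forall (a : R[i]) f g, S f -> S g -> S (fun x => a * f x + g x)
    & hclosure S `<=` S].

Definition orthocomplement S : set (X -> R[i]) :=
  [set f | carrier H f /\ forall g, S g -> inner H f g = 0].

(* [xget] picks the unique element satisfying the predicate, which exists when
   Q is a closed subspace and f is in H. *)
Definition hproj Q f : X -> R[i] :=
  xget (fun=> 0) [set g | Q g /\ orthocomplement Q (fun x => f x - g x)].

(* Adjoint of a bounded operator T : Q -> Q; the chosen h is the Riesz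
   representative of f |-> <T f, g> on the Hilbert space Q. *)
Definition adjoint Q (T : (X -> R[i]) -> (X -> R[i])) g : X -> R[i] :=
  xget (fun=> 0)
    [set h | Q h /\ forall f, Q f -> inner H (T f) g = inner H f h].

Section Module.
Variables (I : Type) (coord : I -> X -> R[i]).

Definition mulop (i : I) f : X -> R[i] := fun x => coord i x * f x.

Definition submodule S : Prop :=
  closed_subspace S /\ forall i f, S f -> S (mulop i f).

Definition quotient_module Q : Prop :=
  closed_subspace Q /\ submodule (orthocomplement Q).

Definition compression Q (i : I) f : X -> R[i] := hproj Q (mulop i f).

End Module.

Definition doubly_commuting n (coord : 'I_n -> X -> R[i]) Q : Prop :=
  forall i j : 'I_n, (i < j)%N -> forall f, Q f ->
    compression coord Q i (adjoint Q (compression coord Q j) f) =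
    adjoint Q (compression coord Q j) (compression coord Q i f).

End HilbertFunSpace.

Definition disc (R : realType) := {z : R[i] | `|z| < 1}.

Definition polydisc (R : realType) (n : nat) := 'I_n -> disc R.

Definition disc_coord (R : realType) (_ : unit) (z : disc R) : R[i] := val z.

Definition polydisc_coord (R : realType) n (i : 'I_n) (z : polydisc R n) :
  R[i] := val (z i).

(* Since f only lives on the open set e(X) of V, it is complex differentiable
   iff some extension to V is differentiable at every point of e(X). *)
Definition holomorphic (R : realType) (X : Type) (V : normedModType R[i])
    (e : X -> V) (f : X -> R[i]) : Prop :=
  exists g : V -> R[i]^o,
    (forall x, f x = g (e x)) /\ (forall x, differentiable g (e x)).

Definition disc_emb (R : realType) (z : disc R) : R[i]^o := val z.

Definition polydisc_emb (R : realType) n (z : polydisc R n) : 'rV[R[i]]_n :=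
  \row_i val (z i).

Definition extend0 (R : realType) (f : disc R -> R[i]) (z : R[i]) : R[i] :=
  oapp f 0 (insub z).

(* The integral of |f|^2 against
   dA_alpha = (alpha + 1) (1 - |z|^2)^alpha dx dy / pi,  z = x + i y. *)
Definition bergman_integral (R : realType) (alpha : int) (f : disc R -> R[i]) :
    \bar R :=
  (\int[lebesgue_measure \x lebesgue_measure]_(p in
      [set p : R * R | (p.1 ^+ 2 + p.2 ^+ 2 < 1)%R])
    (complex.Re (`|extend0 f (p.1 +i* p.2)| ^+ 2) *
     ((alpha%:~R + 1) * (1 - (p.1 ^+ 2 + p.2 ^+ 2)) ^ alpha / pi))%:E)%E.

Definition disc_kernel (R : realType) (alpha : int) (z w : disc R) : R[i] :=
  (1 - val z * (val w)^*) ^ (- (alpha + 2)).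

Definition polydisc_kernel (R : realType) n (alpha : 'I_n -> int)
    (z w : polydisc R n) : R[i] :=
  \prod_(i < n) disc_kernel (alpha i) (z i) (w i).

(* By polarization the norm determines the inner product
   <f, g> = int f conj(g) dA_alpha, hence also the reproducing kernel; the last
   clause only records the classical formula for it. *)
Definition disc_bergman (R : realType) (alpha : int)
    (A : hilbert_fun_space R (disc R)) : Prop :=
  [/\ forall f, carrier A f <->
        holomorphic (@disc_emb R) f /\ (bergman_integral alpha f < +oo)%E,
      forall f, carrier A f -> ((hnorm A f ^+ 2)%:E = bergman_integral alpha f)%E
    & reproducing_kernel A (disc_kernel alpha)].

(* A Hilbert space of functions is determined by its reproducing kernel
   (Moore-Aronszajn), so at most one carrier and inner product qualify. *)
Definition polydisc_bergman (R : realType) n (alpha : 'I_n -> int)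
    (H : hilbert_fun_space R (polydisc R n)) : Prop :=
  (forall f, carrier H f -> holomorphic (@polydisc_emb R n) f) /\
  reproducing_kernel H (polydisc_kernel alpha).

Definition pure_tensor (R : realType) n (F : 'I_n -> disc R -> R[i]) :
  polydisc R n -> R[i] := fun z => \prod_(i < n) F i (z i).

Definition tensor_span (R : realType) n (Q : 'I_n -> set (disc R -> R[i])) :
    set (polydisc R n -> R[i]) :=
  [set f | exists (m : nat) (c : 'I_m -> R[i])
                  (F : 'I_m -> 'I_n -> disc R -> R[i]),
     (forall k i, Q i (F k i)) /\
     f = (fun z => \sum_(k < m) c k * pure_tensor (F k) z)].

(* Under f_1 (x) ... (x) f_n |-> f_1(z_1) ... f_n(z_n), the Hilbert space
   tensor product of the Q_i is the closed linear span of elementary tensors. *)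
Definition hilbert_tensor (R : realType) n
    (H : hilbert_fun_space R (polydisc R n))
    (Q : 'I_n -> set (disc R -> R[i])) : set (polydisc R n -> R[i]) :=
  hclosure H (tensor_span Q).

(* Main.v *)
Require Import Defs.
From HB Require Import structures.
From mathcomp Require Import all_boot all_order all_algebra.
From mathcomp Require Import all_classical all_reals all_analysis.
From mathcomp Require Import complex ring lra.

(** Write [k_w] for the kernel functions, [P] for the projection onto the
    quotient module [Q], [C_i = P M_i P] for the compressions, [m_i] for
    [alpha_i + 2] and [e = P 1].  The spaces enter only through their kernels,
    products of factors [(1 - z_i conj w_i)^(-m_i)].

    Suppose that [Q] is doubly commuting.  As [alpha_i] is an integer, the
    reciprocal of the kernel is a polynomial, so that one can form the defect
    operators [D_i], the values at [C_i] of the hereditary polynomials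
    [(1 - z conj w)^(m_i)].  For the multiplications [M_i] themselves the product
    of these values is [f |-> f(0) 1].  Because the [C_i] doubly commute, the
    product of the [D_i] is the compression of that operator, the rank one map
    [f |-> <f, e> e] ([prod_defects_rank1]).  Each [D_i] commutes with the
    operators built from the [C_j], [j <> i]; hence the functional
    [T |-> <T e, e>] is multiplicative, up to constants, on products of operators
    built from different [C_i] ([defect_vacuum]).  Now [P k_w] is the product of
    the [(1 - conj w_i C_i)^(-m_i)] applied to [e] ([kernel_orbit]), and therefore
    the kernel [(P k_w)(z)] of [Q] is a product of functions of [(z_i, w_i)]
    ([kernel_factorization]).  A product kernel belongs to a tensor product: the
    complement of the factor [Q_i] consists of the functions of [z_i] alone that
    are orthogonal to [Q] ([factors_of_factorization]).

    Conversely, in a tensor product of quotient modules, [M_j^*] and [P M_i] map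
    pure tensors to pure tensors, changing only slot [j], respectively slot [i];
    so they commute on pure tensors, hence on [Q] ([tensor_commute]).

    That pure tensors belong to the space, that their inner products are products
    and that multiplication by a coordinate is a contraction is deduced from the
    positivity of kernels: a function [h] lies in the space with norm at most [b]
    as soon as [b^2 K(z, w) - h(z) conj h(w)] is positive ([psd_member]), a
    consequence of the Riesz representation theorem ([riesz]). *)

Set Implicit Arguments.
Unset Strict Implicit.
Unset Printing Implicit Defensive.
Import Order.TTheory GRing.Theory Num.Theory.
Local Open Scope ring_scope.

(** * Hilbert spaces of functions as inner product spaces *)

Section ComplexReal.
Variable R : realType.
Implicit Types (x y : R[i]) (r : R).

Lemma ReD x y : complex.Re (x + y) = complex.Re x + complex.Re y.
Proof. by case: x; case: y. Qed.

Lemma ReN x : complex.Re (- x) = - complex.Re x.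
Proof. by case: x. Qed.

Lemma ReJ x : complex.Re x^* = complex.Re x.
Proof. by case: x. Qed.

Lemma Re_rmul r x : complex.Re (real_complex R r * x) = r * complex.Re x.
Proof. by case: x => a b /=; rewrite mul0r subr0. Qed.

Lemma Im_ReNi x : complex.Im x = - complex.Re ('i%C * x).
Proof. by case: x => a b /=; rewrite mul0r mul1r sub0r opprK. Qed.

Lemma eq_Re_Im x y : complex.Re x = complex.Re y -> complex.Im x = complex.Im y ->
  x = y.
Proof. by case: x; case: y => ? ? ? ? /= -> ->. Qed.

Lemma Re_mulJ x : complex.Re (x * x^*) = complex.Re x ^+ 2 + complex.Im x ^+ 2.
Proof. by case: x => a b /=; rewrite mulrN opprK !expr2. Qed.

Lemma ge0_real x : 0 <= x -> x = real_complex R (complex.Re x).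
Proof. by move=> /ger0_real/RRe_real. Qed.

Lemma Re_ge0 x : 0 <= x -> 0 <= complex.Re x.
Proof. by rewrite lecE /= => /andP[]. Qed.

End ComplexReal.

Section Space.
Variables (R : realType) (X : Type) (H : hilbert_fun_space R X).

Record hsp := Hsp { hfun :> X -> R[i]; hfunP : carrier H hfun }.

HB.instance Definition _ := gen_eqMixin hsp.
HB.instance Definition _ := gen_choiceMixin hsp.

Lemma hspP (u v : hsp) : (forall x, u x = v x) -> u = v.
Proof.
case: u v => f cf [g cg] /= /funext fg; case: _ / fg cg => cg.
by congr Hsp; apply: Prop_irrelevance.
Qed.

Definition hlin a (u v : hsp) := Hsp (carrier_lin a (hfunP u) (hfunP v)).
Definition hzero := Hsp (carrier0 H).
Definition hadd u v := hlin 1 u v.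
Definition hopp u := hlin (-1) u hzero.

Fact haddA : associative hadd.
Proof. by move=> u v w; apply: hspP => x /=; rewrite !mul1r addrA. Qed.
Fact haddC : commutative hadd.
Proof. by move=> u v; apply: hspP => x /=; rewrite !mul1r addrC. Qed.
Fact hadd0 : left_id hzero hadd.
Proof. by move=> u; apply: hspP => x /=; rewrite mul1r add0r. Qed.
Fact haddN : left_inverse hzero hopp hadd.
Proof. by move=> u; apply: hspP => x /=; rewrite mul1r mulN1r addr0 addNr. Qed.

HB.instance Definition _ := GRing.isZmodule.Build hsp haddA haddC hadd0 haddN.

Lemma hspD (u v : hsp) x : (u + v) x = u x + v x.
Proof. by rewrite [LHS]/= mul1r. Qed.

Definition hscale a (u : hsp) := hlin a u 0.

Lemma hscaleE a u x : hscale a u x = a * u x.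
Proof. by rewrite /= addr0. Qed.

Fact hscaleA a b u : hscale a (hscale b u) = hscale (a * b) u.
Proof. by apply: hspP => x; rewrite !hscaleE mulrA. Qed.
Fact hscale1 : left_id 1 hscale.
Proof. by move=> u; apply: hspP => x; rewrite hscaleE mul1r. Qed.
Fact hscaleDr : right_distributive hscale +%R.
Proof. by move=> a u v; apply: hspP => x; rewrite hspD !hscaleE hspD mulrDr. Qed.
Fact hscaleDl u : {morph hscale^~ u : a b / a + b}.
Proof. by move=> a b; apply: hspP => x; rewrite hspD !hscaleE mulrDl. Qed.

HB.instance Definition _ := GRing.Zmodule_isLmodule.Build R[i] hsp
  hscaleA hscale1 hscaleDr hscaleDl.

Lemma hspZ a (u : hsp) x : (a *: u) x = a * u x.
Proof. exact: hscaleE. Qed.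

Lemma hspN (u : hsp) x : (- u) x = - u x.
Proof. by rewrite -scaleN1r hspZ mulN1r. Qed.

Lemma hspB (u v : hsp) x : (u - v) x = u x - v x.
Proof. by rewrite hspD hspN. Qed.

Lemma hsp_sum I (r : seq I) (F : I -> hsp) x :
  (\sum_(i <- r) F i) x = \sum_(i <- r) F i x.
Proof. by apply: (big_morph (fun u : hsp => u x)) => // u v; rewrite hspD. Qed.

Lemma hlinE a (u v : hsp) : (fun x => a * u x + v x) = hfun (a *: u + v).
Proof. by apply/funext => x; rewrite hspD hspZ. Qed.

Lemma hsubE (u v : hsp) : (fun x => u x - v x) = hfun (u - v).
Proof. by apply/funext => x; rewrite hspB. Qed.

Definition ip (u v : hsp) := inner H u v.

Lemma ipC u v : ip v u = (ip u v)^*.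
Proof. by apply: inner_conj; apply: hfunP. Qed.

Lemma ip_lin a u v w : ip (a *: u + v) w = a * ip u w + ip v w.
Proof. by rewrite /ip -hlinE inner_lin //; apply: hfunP. Qed.

Lemma ipDl u v w : ip (u + v) w = ip u w + ip v w.
Proof. by rewrite -[u]scale1r ip_lin mul1r scale1r. Qed.

Lemma ip0l w : ip 0 w = 0.
Proof. by apply: (addrI (ip 0 w)); rewrite -ipDl !addr0. Qed.

Lemma ipZl a u w : ip (a *: u) w = a * ip u w.
Proof. by rewrite -[a *: u]addr0 ip_lin ip0l addr0. Qed.

Lemma ipNl u w : ip (- u) w = - ip u w.
Proof. by rewrite -scaleN1r ipZl mulN1r. Qed.

Lemma ipBl u v w : ip (u - v) w = ip u w - ip v w.
Proof. by rewrite ipDl ipNl. Qed.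

Lemma ipDr u v w : ip u (v + w) = ip u v + ip u w.
Proof. by rewrite ipC ipDl rmorphD /= -!ipC. Qed.

Lemma ipZr a u w : ip u (a *: w) = a^* * ip u w.
Proof. by rewrite ipC ipZl rmorphM /= -ipC. Qed.

Lemma ip0r u : ip u 0 = 0.
Proof. by rewrite ipC ip0l rmorph0. Qed.

Lemma ipNr u w : ip u (- w) = - ip u w.
Proof. by rewrite ipC ipNl rmorphN /= -ipC. Qed.

Lemma ipBr u v w : ip u (v - w) = ip u v - ip u w.
Proof. by rewrite ipDr ipNr. Qed.

Lemma ip_suml I (r : seq I) (F : I -> hsp) w :
  ip (\sum_(i <- r) F i) w = \sum_(i <- r) ip (F i) w.
Proof.
by apply: (big_morph (ip^~ w)) => [u v|]; rewrite ?ipDl ?ip0l.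
Qed.

Lemma ip_ge0 u : 0 <= ip u u.
Proof. by apply: inner_ge0; apply: hfunP. Qed.

Lemma ip_eq0 u : ip u u = 0 -> u = 0.
Proof.
move=> /(inner_def (hfunP u)) u0; apply: hspP => x.
by rewrite u0.
Qed.

Lemma ip_injl u v : (forall w, ip u w = ip v w) -> u = v.
Proof.
by move=> uv; apply/subr0_eq/ip_eq0; rewrite ipBl uv subrr.
Qed.

Lemma ip_injr u v : (forall w, ip w u = ip w v) -> u = v.
Proof. by move=> uv; apply: ip_injl => w; rewrite ipC uv -ipC. Qed.

Definition nrm (u : hsp) : R := hnorm H u.
Definition rip u v : R := complex.Re (ip u v).

Lemma nrm_ge0 u : 0 <= nrm u.
Proof. exact: sqrtr_ge0. Qed.

Lemma nrm_sqr u : nrm u ^+ 2 = rip u u.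
Proof. by rewrite /nrm /hnorm sqr_sqrtr //; apply/Re_ge0/ip_ge0. Qed.

Lemma ip_nrm u : ip u u = real_complex R (nrm u ^+ 2).
Proof. by rewrite nrm_sqr -ge0_real //; apply: ip_ge0. Qed.

Lemma nrm_eq0 u : nrm u = 0 -> u = 0.
Proof. by move=> u0; apply: ip_eq0; rewrite ip_nrm u0 expr0n. Qed.

Lemma nrm0 : nrm 0 = 0.
Proof. by rewrite /nrm /hnorm -/(ip 0 0) ip0l sqrtr0. Qed.

Lemma ripC u v : rip u v = rip v u.
Proof. by rewrite /rip ipC ReJ. Qed.

Lemma ripDl u v w : rip (u + v) w = rip u w + rip v w.
Proof. by rewrite /rip ipDl ReD. Qed.

Lemma ripNl u w : rip (- u) w = - rip u w.
Proof. by rewrite /rip ipNl ReN. Qed.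

Lemma ripZl r u w : rip (real_complex R r *: u) w = r * rip u w.
Proof. by rewrite /rip ipZl Re_rmul. Qed.

Lemma nrmD_sqr u v : nrm (u + v) ^+ 2 = nrm u ^+ 2 + nrm v ^+ 2 + 2 * rip u v.
Proof.
rewrite !nrm_sqr ripDl ![rip _ (u + v)]ripC !ripDl (ripC v u); ring.
Qed.

Lemma nrmN u : nrm (- u) = nrm u.
Proof. by rewrite /nrm /hnorm -![inner _ _ _]/(ip _ _) ipNl ipNr opprK. Qed.

Lemma nrmB_sqr u v : nrm (u - v) ^+ 2 = nrm u ^+ 2 + nrm v ^+ 2 - 2 * rip u v.
Proof. by rewrite nrmD_sqr nrmN ripC ripNl ripC; ring. Qed.

Lemma nrmZr r u : nrm (real_complex R r *: u) ^+ 2 = r ^+ 2 * nrm u ^+ 2.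
Proof. by rewrite !nrm_sqr ripZl ripC ripZl; ring. Qed.

Lemma rip_le u v : rip u v <= nrm u * nrm v.
Proof.
have [u0|u0] := eqVneq (nrm u) 0.
  by rewrite (nrm_eq0 u0) /rip ip0l nrm0 mul0r.
have [v0|v0] := eqVneq (nrm v) 0.
  by rewrite (nrm_eq0 v0) /rip ip0r nrm0 mulr0.
have {}u0 : 0 < nrm u by rewrite lt_def u0 nrm_ge0.
have {}v0 : 0 < nrm v by rewrite lt_def v0 nrm_ge0.
have := sqr_ge0 (nrm (real_complex R (nrm v) *: u - real_complex R (nrm u) *: v)).
rewrite nrmB_sqr !nrmZr ripZl ripC ripZl ripC.
by move=> h; rewrite -(ler_pM2l (mulr_gt0 u0 v0)); lra.
Qed.

Lemma nrmD u v : nrm (u + v) <= nrm u + nrm v.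
Proof.
have nu := nrm_ge0 u; have nv := nrm_ge0 v.
rewrite -ler_sqr ?nnegrE ?nrm_ge0 ?addr_ge0 //.
by have := rip_le u v; rewrite nrmD_sqr sqrrD; lra.
Qed.

Lemma nrmZ_sqr a u :
  nrm (a *: u) ^+ 2 = (complex.Re a ^+ 2 + complex.Im a ^+ 2) * nrm u ^+ 2.
Proof.
rewrite [LHS]nrm_sqr /rip ipZl ipZr ip_nrm; case: a => a b /=; ring.
Qed.

(** Complex Cauchy-Schwarz, in the squared form that positivity of kernels
    produces. *)
Lemma ip_le_sqr u v :
  complex.Re (ip u v) ^+ 2 + complex.Im (ip u v) ^+ 2 <= nrm u ^+ 2 * nrm v ^+ 2.
Proof.
set t := ip u v; set T := _ + _.
have T0 : 0 <= T by rewrite addr_ge0 ?sqr_ge0.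
have := rip_le (t^* *: u) v.
rewrite /rip ipZl -/t mulrC Re_mulJ -/T => TN.
have [->|Tn0] := eqVneq T 0; first by rewrite mulr_ge0 ?sqr_ge0.
have Tp : 0 < T by rewrite lt_def Tn0.
have : T ^+ 2 <= (nrm (t^* *: u) * nrm v) ^+ 2.
  by rewrite ler_sqr // nnegrE ?mulr_ge0 ?nrm_ge0.
rewrite exprMn nrmZ_sqr.
have -> : complex.Re t^* ^+ 2 + complex.Im t^* ^+ 2 = T.
  by rewrite /T; case: (t) => a b /=; rewrite sqrrN.
by rewrite expr2 -mulrA ler_pM2l.
Qed.

End Space.

(** * Riesz representation *)

Section Riesz.
Variables (R : realType) (X : Type) (H : hilbert_fun_space R X).
Implicit Types (u v w : hsp H).

Lemma hsp_complete (u : nat -> hsp H) :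
  (forall e, 0 < e -> exists N : nat, forall m n,
     (N <= m)%N -> (N <= n)%N -> nrm (u m - u n) < e) ->
  exists h, forall e, 0 < e -> exists N : nat, forall n, (N <= n)%N ->
    nrm (u n - h) < e.
Proof.
move=> uC; have [||f cf uf] := @hilbert_complete _ _ H (fun n => u n).
- by move=> n; apply: hfunP.
- move=> e /uC[N uN]; exists N => m n Nm Nn.
  by have := uN m n Nm Nn; rewrite /nrm /hnorm -hsubE.
exists (Hsp cf) => e /uf[N uN]; exists N => n Nn.
by have := uN n Nn; rewrite /nrm /hnorm -hsubE.
Qed.

Lemma archi_lt (d : R) : 0 < d -> exists N : nat, N.+1%:R^-1 < d.
Proof.
move=> d0; exists (Num.truncn d^-1).
rewrite -[ltRHS]invrK ltf_pV2 ?posrE ?ltr0n ?invr_gt0 //.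
exact: truncnS_gt.
Qed.

(** The representing vector minimizes [|v|^2 - 2 Re t] over the pairs [(v, t)]
    of [G].  A linear relation in place of a functional lets [G] be given by
    generators, such as combinations of kernel functions; that [t] depends on
    [v] alone follows from the bound. *)
Lemma riesz (G : hsp H -> R[i] -> Prop) (B : R) : 0 <= B -> G 0 0 ->
  (forall a u s v t, G u s -> G v t -> G (a *: u + v) (a * s + t)) ->
  (forall u s, G u s -> complex.Re s <= B * nrm u) ->
  exists h, [/\ forall u s, G u s -> s = ip u h, nrm h <= B &
    forall e, 0 < e -> exists u s, G u s /\ nrm (u - h) < e].
Proof.
move=> B0 G0 Glin GB.
pose J u s := nrm u ^+ 2 - 2 * complex.Re s.
have JB u s : G u s -> - B ^+ 2 <= J u s.
  move=> /GB; rewrite /J => GBu.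
  have := sqr_ge0 (nrm u - B); rewrite sqrrB; lra.
pose E := [set x : R | exists u s, G u s /\ x = J u s]%classic.
have Einf : has_inf E.
  split; first by exists (J 0 0), 0, 0.
  by exists (- B ^+ 2) => _ [u [s [/JB Gus ->]]].
pose m := inf E.
have mJ u s : G u s -> m <= J u s.
  by move=> Gus; apply: ge_inf; [case: Einf | exists u, s].
have JG a b u s v t : G u s -> G v t ->
  G (a *: u + b *: v) (a * s + b * t).
  move=> Gu Gv; apply: (Glin) => //.
  by rewrite -[b *: v]addr0 -[b * t]addr0; apply: Glin.
have near_min d : 0 < d -> exists us, G us.1 us.2 /\ J us.1 us.2 < m + d.
  move=> d0; have [_ [u [s [Gus ->]]] lt_us] := inf_adherent d0 Einf.
  by exists (u, s).
(* By the parallelogram law two almost minimizers are close, since their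
   midpoint cannot do better than the infimum. *)
have close d u s v t : G u s -> G v t -> J u s < m + d -> J v t < m + d ->
    nrm (u - v) ^+ 2 < 4 * d.
  move=> Gus Gvt Ju Jv.
  have := mJ _ _ (JG (real_complex R (2^-1)) (real_complex R (2^-1)) _ _ _ _ Gus Gvt).
  move: Ju Jv; rewrite /J nrmB_sqr nrmD_sqr !nrmZr ripZl ripC ripZl (ripC v).
  rewrite ReD !Re_rmul; lra.
have [us usP] := choice (fun n : nat =>
  near_min n.+1%:R^-1 (ltac:(by rewrite invr_gt0 ltr0n))).
have usd d : 0 < d -> exists N : nat, forall n, (N <= n)%N ->
    J (us n).1 (us n).2 < m + d.
  move=> d0; have [N Nd] := archi_lt d0; exists N => n Nn.
  have [_ /lt_le_trans] := usP n; apply.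
  rewrite lerD2l; apply: ltW; apply: le_lt_trans Nd.
  by rewrite lef_pV2 ?posrE ?ltr0n // ler_nat ltnS.
have [|h hP] := @hsp_complete (fun n => (us n).1).
  move=> e e0; have e4 : 0 < e ^+ 2 / 4 by rewrite divr_gt0 ?exprn_gt0.
  have [N uN] := usd _ e4; exists N => p q Np Nq.
  rewrite -ltr_sqr ?nnegrE ?nrm_ge0 ?ltW //.
  have -> : e ^+ 2 = 4 * (e ^+ 2 / 4) by field.
  by apply: close (uN p Np) (uN q Nq); case: (usP p); case: (usP q).
have approx e : 0 < e -> exists u s, [/\ G u s, J u s < m + e & nrm (u - h) < e].
  move=> e0; have [N uN] := usd _ e0; have [k uk] := hP _ e0.
  exists (us (maxn N k)).1, (us (maxn N k)).2; split.
  - by case: (usP (maxn N k)).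
  - by apply: uN; apply: leq_maxl.
  - by apply: uk; apply: leq_maxr.
have variation z t : G z t -> 0 <= nrm z ^+ 2 + 2 * (rip z h - complex.Re t).
  move=> Gzt; apply/ler_addgt0Pr => e e0.
  have q0 : 0 < 1 + 2 * nrm z by have := nrm_ge0 z; lra.
  pose d := e / (1 + 2 * nrm z); have d0 : 0 < d by rewrite divr_gt0.
  have dE : d * (1 + 2 * nrm z) = e by rewrite divfK ?gt_eqF.
  have [u [s [Gus Ju uh]]] := approx _ d0.
  have := mJ _ _ (Glin 1 _ _ _ _ Gus Gzt).
  have : rip (u - h) z <= d * nrm z.
    apply: le_trans (rip_le _ _) _.
    by rewrite ler_wpM2r ?nrm_ge0 // ltW.
  move: Ju; rewrite /J scale1r mul1r nrmD_sqr ReD ripDl ripNl (ripC h).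
  move: dE; rewrite mulrDr; lra.
have rip_h z t : G z t -> complex.Re t = rip z h.
  move=> Gzt; pose q := nrm z ^+ 2 + 1; pose d := rip z h - complex.Re t.
  have q0 : 0 < q by have := sqr_ge0 (nrm z); rewrite /q; lra.
  have := variation _ _ (JG (real_complex R (- d / q)) 0 _ _ _ _ Gzt G0).
  rewrite scale0r mul0r !addr0 nrmZr ripZl Re_rmul -mulrBr -/d.
  have -> : nrm z ^+ 2 = q - 1 by rewrite /q addrK.
  have -> : (- d / q) ^+ 2 * (q - 1) + 2 * (- d / q * d) =
      - ((d / q) ^+ 2 * (q + 1)) by field; rewrite gt_eqF.
  have q1 : 0 < q + 1 by lra.
  rewrite oppr_ge0 pmulr_lle0 // => dq.
  have /eqP : (d / q) ^+ 2 = 0 by apply/eqP; rewrite eq_le dq sqr_ge0.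
  rewrite sqrf_eq0 mulf_eq0 invr_eq0 (gt_eqF q0) orbF /d subr_eq0.
  by move=> /eqP ->.
exists h; split.
- move=> u s Gus; apply: eq_Re_Im; first exact: rip_h.
  have Gi : G ('i%C *: u) ('i%C * s).
    by have := JG 'i%C 0 _ _ _ _ Gus G0; rewrite scale0r mul0r !addr0.
  by rewrite !Im_ReNi (rip_h _ _ Gi) /rip ipZl.
- rewrite -ler_sqr ?nnegrE ?nrm_ge0 // leNgt; apply/negP => hB.
  have d0 : 0 < nrm h ^+ 2 - B ^+ 2 by rewrite subr_gt0.
  have [u [s [Gus _ uh]]] := approx (Num.sqrt (nrm h ^+ 2 - B ^+ 2)) (ltac:(by rewrite sqrtr_gt0)).
  have : nrm (u - h) ^+ 2 < nrm h ^+ 2 - B ^+ 2.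
    by rewrite -[ltRHS]sqr_sqrtr ?ltW // ltr_sqr ?nnegrE ?nrm_ge0 ?sqrtr_ge0.
  have := JB _ _ Gus; rewrite /J (rip_h _ _ Gus) nrmB_sqr; lra.
- by move=> e /approx[u [s [Gus _ uh]]]; exists u, s.
Qed.
End Riesz.

(** * Orthogonality and closure *)

Section Orthogonality.
Variables (R : realType) (X : Type) (H : hilbert_fun_space R X).
Implicit Types (u v w : hsp H) (S : hsp H -> Prop).

Definition hlinear S := S 0 /\ forall a u v, S u -> S v -> S (a *: u + v).

Definition perp S u := forall v, S v -> ip u v = 0.

Definition adherent S u := forall e, 0 < e -> exists v, S v /\ nrm (u - v) < e.

Lemma perp_linear S : hlinear (perp S).
Proof.
split=> [v _|a u v Su Sv w Sw]; first exact: ip0l.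
by rewrite ip_lin Su // Sv // mulr0 addr0.
Qed.

(** The orthogonal projection onto the closure of [S], obtained by representing
    the functional [v |-> <v, u>] restricted to [S]. *)
Lemma nearest_vector S u : hlinear S ->
  exists h, adherent S h /\ forall v, S v -> ip v u = ip v h.
Proof.
move=> [S0 Slin].
have [||||h [hP _ hS]] := @riesz _ _ H (fun v t => S v /\ t = ip v u) (nrm u).
- exact: nrm_ge0.
- by split; rewrite ?ip0l.
- by move=> a v s w t [Sv ->] [Sw ->]; split; [apply: Slin|rewrite ip_lin].
- by move=> v s [_ ->]; rewrite mulrC; apply: rip_le.
exists h; split=> [e /hS[v [s [[Sv _] vh]]]|v Sv]; last exact: hP.
by exists v; split=> //; rewrite -nrmN opprB.
Qed.

Lemma adherent_biperp S u : adherent S u -> perp (perp S) u.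
Proof.
move=> uS v Sv; set t := ip u v.
pose T := complex.Re t ^+ 2 + complex.Im t ^+ 2; pose N := nrm v ^+ 2 + 1.
have N0 : 0 < N by have := sqr_ge0 (nrm v); rewrite /N; lra.
suff T0 : T = 0.
  apply: eq_Re_Im => /=; apply/eqP; rewrite -sqrf_eq0 eq_le sqr_ge0 andbT -T0.
    by rewrite lerDl sqr_ge0.
  by rewrite lerDr sqr_ge0.
apply/eqP; rewrite eq_le addr_ge0 ?sqr_ge0 // andbT; apply/ler_addgt0Pl => e e0.
have eN : 0 < e / N by rewrite divr_gt0.
have [w [Sw uw]] := uS (Num.sqrt (e / N)) (ltac:(by rewrite sqrtr_gt0)).
have := ip_le_sqr (u - w) v.
rewrite ipBl [ip w v]ipC Sv // conjC0 subr0 -/t -/T addr0 => /le_trans; apply.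
apply: (@le_trans _ _ (e / N * N)); last by rewrite divfK ?gt_eqF.
apply: ler_pM; rewrite ?sqr_ge0 //; last by rewrite lerDl.
by rewrite -[leRHS]sqr_sqrtr ?ler_sqr ?nnegrE ?nrm_ge0 ?sqrtr_ge0 // ltW.
Qed.

Lemma biperp_adherent S u : hlinear S -> perp (perp S) u -> adherent S u.
Proof.
move=> Slin uS; have [h [hS hP]] := nearest_vector u Slin.
have uh : perp S (u - h).
  by move=> v Sv; rewrite ipC ipBr hP // subrr conjC0.
suff -> : u = h by [].
apply/subr0_eq/ip_eq0.
by rewrite ipBl uS // (adherent_biperp hS) // subrr.
Qed.

End Orthogonality.

(** * Bounded and adjointable operators *)

Section Adjoints.
Variables (R : realType) (X Y : Type).
Variables (A : hilbert_fun_space R X) (B : hilbert_fun_space R Y).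

Lemma bounded_adjoint (T : hsp A -> hsp B) (b : R) : 0 <= b ->
  (forall a u v, T (a *: u + v) = a *: T u + T v) ->
  (forall u, nrm (T u) <= b * nrm u) ->
  exists T', forall v u, ip (T u) v = ip u (T' v).
Proof.
move=> b0 Tlin Tb.
suff /choice[T' TT'] : forall v, exists w, forall u, ip (T u) v = ip u w by exists T'.
move=> v.
have T0 : T 0 = 0.
  by have := Tlin (-1) 0 0; rewrite scaler0 add0r scaleN1r addNr.
have [||||h [hP _ _]] := @riesz _ _ A (fun u t => t = ip (T u) v) (b * nrm v).
- by rewrite mulr_ge0 ?nrm_ge0.
- by rewrite T0 ip0l.
- by move=> a u s w t -> ->; rewrite Tlin ip_lin.
- move=> u s ->; apply: le_trans (rip_le _ _) _.
  by rewrite mulrAC ler_wpM2r ?nrm_ge0.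
by exists h => u; apply: hP.
Qed.

End Adjoints.

Section AdjointableOperators.
Variables (R : realType) (X : Type) (H : hilbert_fun_space R X).
Implicit Types (u v w : hsp H).

(** The existence of an adjoint forces linearity.  Carrying the adjoint along
    makes these operators a ring with involution, in which the commutation
    arguments become ring computations. *)
Record adjop := Adjop {
  aop :> hsp H -> hsp H;
  asop : hsp H -> hsp H;
  aopP : forall u v, ip (aop u) v = ip u (asop v) }.

HB.instance Definition _ := gen_eqMixin adjop.
HB.instance Definition _ := gen_choiceMixin adjop.

Implicit Types (S T C D : adjop).

Lemma adjopP S T : (forall u, S u = T u) -> S = T.
Proof.
case: S T => s s' sP [t t' tP] /= /funext st; case: _ / st tP => tP.
have st' : s' = t' by apply/funext => v; apply: ip_injr => w; rewrite -sP.
by case: _ / st' tP => tP; congr Adjop; apply: Prop_irrelevance.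
Qed.

Lemma aop_lin T a u v : T (a *: u + v) = a *: T u + T v.
Proof. by apply: ip_injl => w; rewrite ip_lin !aopP ip_lin. Qed.

Lemma aopZ T a u : T (a *: u) = a *: T u.
Proof. by apply: ip_injl => w; rewrite ipZl !aopP ipZl. Qed.

Lemma aop_add T u v : T (u + v) = T u + T v.
Proof. by apply: ip_injl => w; rewrite ipDl !aopP ipDl. Qed.

Lemma aop_sub T u v : T (u - v) = T u - T v.
Proof. by apply: ip_injl => w; rewrite ipBl !aopP ipBl. Qed.

Lemma aop_0 T : T 0 = 0.
Proof. by apply: ip_injl => w; rewrite aopP !ip0l. Qed.

Definition star T : adjop.
Proof.
by exists (asop T) T => u v; rewrite ipC -aopP -ipC.
Defined.

Lemma starP T u v : ip (T u) v = ip u (star T v).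
Proof. exact: aopP. Qed.

Lemma starK T : star (star T) = T.
Proof. exact: adjopP. Qed.

Lemma star_eq S T : (forall u v, ip (S u) v = ip u (T v)) -> star S = T.
Proof. by move=> ST; apply: adjopP => v; apply: ip_injr => u; rewrite -starP. Qed.

Definition adj_add S T : adjop.
Proof.
by exists (fun u => S u + T u) (fun u => star S u + star T u) => u v;
  rewrite ipDl !starP ipDr.
Defined.

Definition adj_opp S : adjop.
Proof.
by exists (fun u => - S u) (fun u => - star S u) => u v; rewrite ipNl starP ipNr.
Defined.

Definition adj_mul S T : adjop.
Proof. by exists (S \o T) (star T \o star S) => u v; rewrite /= !starP. Defined.

Definition adj_scale (a : R[i]) : adjop.
Proof.
by exists (fun u => a *: u) (fun u => a^* *: u) => u v; rewrite ipZl ipZr conjCK.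
Defined.

Fact adj_addA : associative adj_add.
Proof. by move=> S T D; apply: adjopP => u /=; rewrite addrA. Qed.
Fact adj_addC : commutative adj_add.
Proof. by move=> S T; apply: adjopP => u /=; rewrite addrC. Qed.
Fact adj_add0 : left_id (adj_scale 0) adj_add.
Proof. by move=> S; apply: adjopP => u /=; rewrite scale0r add0r. Qed.
Fact adj_addN : left_inverse (adj_scale 0) adj_opp adj_add.
Proof. by move=> S; apply: adjopP => u /=; rewrite scale0r addNr. Qed.
Fact adj_mulA : associative adj_mul.
Proof. by move=> S T D; apply: adjopP. Qed.
Fact adj_mul1 : left_id (adj_scale 1) adj_mul.
Proof. by move=> S; apply: adjopP => u /=; rewrite scale1r. Qed.
Fact adj_mulr1 : right_id (adj_scale 1) adj_mul.
Proof. by move=> S; apply: adjopP => u /=; rewrite scale1r. Qed.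
Fact adj_mulDl : left_distributive adj_mul adj_add.
Proof. by move=> S T D; apply: adjopP. Qed.
Fact adj_mulDr : right_distributive adj_mul adj_add.
Proof. by move=> S T D; apply: adjopP => u /=; rewrite aop_add. Qed.

HB.instance Definition _ :=
  GRing.isZmodule.Build adjop adj_addA adj_addC adj_add0 adj_addN.
HB.instance Definition _ := GRing.Zmodule_isPzRing.Build adjop
  adj_mulA adj_mul1 adj_mulr1 adj_mulDl adj_mulDr.

Lemma aopB S T u : (S - T) u = S u - T u. Proof. by []. Qed.
Lemma aopM S T u : (S * T) u = S (T u). Proof. by []. Qed.
Lemma aop1 u : (1 : adjop) u = u. Proof. exact: scale1r. Qed.
Lemma aop0 u : (0 : adjop) u = 0. Proof. exact: scale0r. Qed.
Lemma aop_scale a u : adj_scale a u = a *: u. Proof. by []. Qed.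

Lemma starM S T : star (S * T) = star T * star S. Proof. exact: adjopP. Qed.
Lemma starB S T : star (S - T) = star S - star T. Proof. exact: adjopP. Qed.
Lemma star1 : star 1 = 1.
Proof. by apply: star_eq => u v; rewrite !aop1. Qed.

Lemma star_scale a : star (adj_scale a) = adj_scale a^*.
Proof. exact: adjopP. Qed.

Lemma comm_scale a T : GRing.comm T (adj_scale a).
Proof. by apply: adjopP => u; rewrite !aopM !aop_scale aopZ. Qed.

Lemma comm_star S T : GRing.comm S T -> GRing.comm (star S) (star T).
Proof. by move=> ST; rewrite /GRing.comm -!starM ST. Qed.

Definition contraction T := forall u, nrm (T u) <= nrm u.

Lemma contraction_star T : contraction T -> contraction (star T).
Proof.
move=> Tc u; have [->|u0] := eqVneq (nrm (star T u)) 0; first exact: nrm_ge0.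
have {}u0 : 0 < nrm (star T u) by rewrite lt_def u0 nrm_ge0.
rewrite -(ler_pM2l u0) -expr2 nrm_sqr /rip -starP.
apply: le_trans (rip_le _ _) _; rewrite ler_wpM2r ?nrm_ge0 //.
Qed.

Lemma contractionM S T : contraction S -> contraction T -> contraction (S * T).
Proof. by move=> Sc Tc u; apply: le_trans (Tc u); apply: Sc. Qed.

Lemma star_projection_contraction T : star T = T -> T * T = T -> contraction T.
Proof.
move=> sT TT u; have [->|u0] := eqVneq (nrm (T u)) 0; first exact: nrm_ge0.
have {}u0 : 0 < nrm (T u) by rewrite lt_def u0 nrm_ge0.
rewrite -(ler_pM2l u0) -expr2 nrm_sqr {1}/rip starP sT -aopM TT -/(rip _ _) ripC.
exact: rip_le.
Qed.

Lemma bounded_adjop (T : hsp H -> hsp H) (b : R) : 0 <= b ->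
  (forall a u v, T (a *: u + v) = a *: T u + T v) ->
  (forall u, nrm (T u) <= b * nrm u) -> exists T' : adjop, aop T' = T.
Proof.
move=> b0 Tlin Tb; have [T' TT'] := bounded_adjoint b0 Tlin Tb.
by exists (Adjop (fun u v => TT' v u)).
Qed.

Lemma nrmZ a u : nrm (a *: u) = complex.Re `|a| * nrm u.
Proof.
apply: (@pexpIrn _ 2) => //; rewrite ?nnegrE ?mulr_ge0 ?nrm_ge0 ?Re_ge0 //.
rewrite nrmZ_sqr exprMn; congr (_ * _).
apply: complexI; rewrite add_Re2_Im2 [in LHS](ge0_real (normr_ge0 a)).
by rewrite -rmorphXn.
Qed.

Lemma resolvent_bound T a u : contraction T ->
  (1 - complex.Re `|a|) * nrm u <= nrm ((1 - adj_scale a * T) u).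
Proof.
move=> Tc; rewrite aopB aop1 aopM aop_scale mulrBl mul1r lerBlDr.
have {1}-> : u = (u - a *: T u) + a *: T u by rewrite subrK.
apply: le_trans (nrmD _ _) _; rewrite lerD2l nrmZ.
by rewrite ler_wpM2l ?Re_ge0.
Qed.

Lemma resolvent_solve T a g : contraction T -> `|a| < 1 ->
  exists h, (1 - adj_scale a^* * star T) h = g.
Proof.
move=> Tc; rewrite ltcE /= => /andP[_ a1].
have d0 : 0 < 1 - complex.Re `|a| by rewrite subr_gt0.
pose L := 1 - adj_scale a * T.
have [||||h [hP _ _]] := @riesz _ _ H
    (fun v t => exists u, v = L u /\ t = ip u g) (nrm g / (1 - complex.Re `|a|)).
- by rewrite divr_ge0 ?nrm_ge0 ?ltW.
- by exists 0; rewrite aop_0 ip0l.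
- move=> b _ _ _ _ [u [-> ->]] [w [-> ->]]; exists (b *: u + w).
  by rewrite aop_lin ip_lin.
- move=> _ _ [u [-> ->]]; apply: le_trans (rip_le _ _) _.
  rewrite mulrC -mulrA ler_wpM2l ?nrm_ge0 // mulrC ler_pdivlMr // mulrC.
  exact: resolvent_bound.
exists h; apply: ip_injr => u; have -> : ip u g = ip (L u) h.
  by apply: hP; exists u.
by rewrite starP starB star1 starM star_scale comm_scale.
Qed.

(** Both [1 - a T] and its adjoint are bounded below, hence injective; each is
    onto because a functional bounded through the other is represented. *)
Lemma resolvent T a : contraction T -> `|a| < 1 ->
  exists S : adjop, S * (1 - adj_scale a * T) = 1 /\ (1 - adj_scale a * T) * S = 1.
Proof.
move=> Tc a1; set L := 1 - _.
have sL : star L = 1 - adj_scale a^* * star T.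
  by rewrite starB star1 starM star_scale comm_scale.
have [r Lr] : exists r, forall g, L (r g) = g.
  suff /choice[r Lr] : forall g, exists h, L h = g by exists r.
  move=> g; rewrite /L -[a]conjCK -[T]starK.
  by apply: resolvent_solve; [apply: contraction_star | rewrite norm_conjC].
have [r' Lr'] : exists r', forall g, star L (r' g) = g.
  suff /choice[r' Lr'] : forall g, exists h, star L h = g by exists r'.
  by move=> g; rewrite sL; apply: resolvent_solve.
have rr' u v : ip (r u) v = ip u (r' v).
  by rewrite -{1}[v]Lr' -starP Lr.
have L0 u : L u = 0 -> u = 0.
  move=> Lu; apply: nrm_eq0; have := resolvent_bound a u Tc.
  rewrite -/L Lu nrm0 pmulr_rle0 => [u0|]; first by apply/eqP; rewrite eq_le u0 nrm_ge0.
  by move: a1; rewrite ltcE /= subr_gt0 => /andP[].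
exists (Adjop rr'); split; apply: adjopP => u; rewrite aopM aop1 //.
by apply/subr0_eq/L0; rewrite aop_sub Lr subrr.
Qed.

End AdjointableOperators.

(** * Closed subspaces, projections and compressions *)

Section Subspaces.
Variables (R : realType) (X : Type) (H : hilbert_fun_space R X).
Implicit Types (u v w : hsp H) (S q : hsp H -> Prop).

(** Membership predicates on [hsp H] and the sets of functions they describe are
    exchanged through [funs], so that the rest can be done with vectors. *)
Definition funs S : set (X -> R[i]) := [set f | exists u, f = hfun u /\ S u]%classic.

Lemma hfun_inj u v : hfun u = hfun v -> u = v.
Proof. by move=> uv; apply: hspP => x; rewrite uv. Qed.

Lemma funsP S u : funs S u <-> S u.
Proof. by split=> [[v [/hfun_inj ->]]|Su] //; exists u. Qed.

Lemma funs_restrict (Q : set (X -> R[i])) : (Q `<=` carrier H)%classic ->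
  Q = funs (fun u => Q u).
Proof.
move=> QH; apply/seteqP; split=> f; last by move=> [u [->]].
by move=> Qf; exists (Hsp (QH _ Qf)).
Qed.

Lemma orthocomplement_funs S : orthocomplement H (funs S) = funs (perp S).
Proof.
apply/seteqP; split=> f.
  by move=> [cf fS]; exists (Hsp cf); split=> // v Sv; apply: fS; exists v.
by move=> [u [-> uS]]; split=> [|_ [v [-> Sv]]]; [apply: hfunP|apply: uS].
Qed.

Lemma hclosure_funs (Q : set (X -> R[i])) :
  hclosure H Q = funs (adherent (fun u => Q u)).
Proof.
apply/seteqP; split=> f.
  move=> [cf fS]; exists (Hsp cf); split=> // e /fS[g [cg Qg fg]].
  by exists (Hsp cg); split=> //; rewrite /nrm -hsubE.
move=> [u [-> uS]]; split=> [|e /uS[v [Qv uv]]]; first exact: hfunP.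
by exists (hfun v); split=> //; [apply: hfunP|rewrite hsubE].
Qed.

Lemma closed_funsP S :
  closed_subspace H (funs S) <-> hlinear S /\ forall u, perp (perp S) u -> S u.
Proof.
split=> [[_ S0 Slin Scl]|[[S0 Slin] Sbi]].
  have Shl : hlinear S.
    split=> [|a u v Su Sv]; first by apply/funsP.
    by apply/funsP; rewrite -hlinE; apply: Slin; apply/funsP.
  split=> // u uS; apply/funsP/Scl; rewrite hclosure_funs; apply/funsP.
  move=> e e0; have [v [Sv uv]] := biperp_adherent Shl uS e0.
  by exists v; split=> //; apply/funsP.
split.
- by move=> _ [u [-> _]]; apply: hfunP.
- by exists 0.
- move=> a _ _ [u [-> Su]] [v [-> Sv]]; exists (a *: u + v).
  by rewrite hlinE; split=> //; apply: Slin.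
- rewrite hclosure_funs => _ [u [-> uS]]; apply/funsP/Sbi/adherent_biperp => e e0.
  by have [v [/funsP Sv uv]] := uS e e0; exists v.
Qed.

Lemma perp_biperp S u : perp (perp (perp S)) u -> perp S u.
Proof. by move=> uS v Sv; apply: uS => w wS; rewrite ipC wS // conjC0. Qed.

Lemma projection_exists q : hlinear q -> (forall u, perp (perp q) u -> q u) ->
  exists P : adjop H, [/\ star P = P, P * P = P & forall u, q u <-> P u = u].
Proof.
move=> qlin qcl.
suff /choice[p pP] : forall u, exists h, q h /\ forall v, q v -> ip v u = ip v h.
  have pid u : q u -> p u = u.
    move=> qu; have [qpu pu] := pP u; apply/subr0_eq/ip_eq0.
    rewrite ipBr -pu ?subrr //.
    by rewrite addrC -scaleN1r; apply: qlin.2.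
  have padj u v : ip (p u) v = ip u (p v).
    rewrite (pP v).2; last exact: (pP u).1.
    by rewrite ipC [RHS]ipC (pP u).2 //; apply: (pP v).1.
  exists (Adjop padj); split=> [||u].
  - by apply: star_eq => u v /=.
  - by apply: adjopP => u; rewrite aopM /= pid //; apply: (pP u).1.
  - by split=> [/pid|<-] //; apply: (pP u).1.
move=> u; have [h [hq hP]] := nearest_vector u qlin.
by exists h; split=> //; apply/qcl/adherent_biperp.
Qed.

Section Projection.
Variables (q : hsp H -> Prop) (P : adjop H).
Hypotheses (sP : star P = P) (PP : P * P = P) (Pq : forall u, q u <-> P u = u).

Lemma projection_in u : q (P u).
Proof. by apply/Pq; rewrite -aopM PP. Qed.

Lemma projection_perp u : perp q u <-> P u = 0.
Proof.
split=> [uq|Pu v /Pq <-]; last by rewrite -{1}sP -starP Pu ip0l.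
apply: ip_eq0; rewrite starP sP -aopM PP.
exact/uq/projection_in.
Qed.

Lemma projection_mul (T : adjop H) : (forall u, perp q u -> perp q (T u)) ->
  P * T = P * T * P.
Proof.
move=> Tperp; apply: adjopP => u; rewrite !aopM; apply/subr0_eq.
rewrite -!aop_sub; apply/projection_perp/Tperp/projection_perp.
by rewrite aop_sub -aopM PP subrr.
Qed.

Lemma hproj_projection u : hproj H (funs q) u = P u.
Proof.
have rP : perp q (u - P u).
  by apply/projection_perp; rewrite aop_sub -aopM PP subrr.
apply: xget_unique => [|f [[v [-> qv]]]].
  split; first exact/funsP/projection_in.
  by rewrite hsubE orthocomplement_funs; apply/funsP.
rewrite hsubE orthocomplement_funs => /funsP/projection_perp.
by rewrite aop_sub ((Pq v).1 qv) => /subr0_eq ->.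
Qed.

Lemma adjoint_projection (T : (X -> R[i]) -> X -> R[i]) (C : adjop H) u :
  (forall v, q v -> T v = C v) -> q (star C u) ->
  adjoint H (funs q) T u = star C u.
Proof.
move=> TC qCu; apply: xget_unique => [|f [[v [-> qv]] vP]].
  split; first exact/funsP.
  by move=> _ [v [-> qv]]; rewrite TC // -[LHS]/(ip (C v) u) starP.
congr hfun; apply/subr0_eq/ip_eq0.
have qz : q (v - star C u) by apply/Pq; rewrite aop_sub !(Pq _).1.
have := vP _ (ex_intro _ _ (conj erefl qz)); rewrite TC // => zP.
by rewrite ipBr -starP; apply/eqP; rewrite subr_eq0; apply/eqP/esym.
Qed.

Section Compressions.
Variables (n : nat) (coord : 'I_n -> X -> R[i]) (M : 'I_n -> adjop H).
Hypothesis ME : forall i u x, (M i u) x = coord i x * u x.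

Lemma mulopE i u : mulop coord i u = M i u.
Proof. by apply/funext => x; rewrite ME. Qed.

Lemma doubly_commutingP : (forall i, P * M i = P * M i * P) ->
  doubly_commuting H coord (funs q) <->
  forall i j : 'I_n, (i < j)%N ->
    GRing.comm (P * M i * P) (star (P * M j * P)).
Proof.
move=> PM; pose C i := P * M i * P.
have sC i : star (C i) = P * star (M i) * P by rewrite !starM sP mulrA.
have compE i u : compression H coord (funs q) i u = C i u.
  by rewrite /compression mulopE hproj_projection -aopM PM.
have adjE j u : adjoint H (funs q) (compression H coord (funs q) j) u = star (C j) u.
  apply: adjoint_projection => [v _|]; first exact: compE.
  by rewrite sC -mulrA aopM; apply: projection_in.
have qC i u : q (C i u) by rewrite /C -mulrA aopM; apply: projection_in.
split=> [dc i j ij|dc i j ij _ [u [-> qu]]].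
  apply: adjopP => u; rewrite -/(C i) -/(C j) [LHS]aopM [RHS]aopM.
  have [-> ->] : star (C j) u = star (C j) (P u) /\ C i u = C i (P u).
    by rewrite -!aopM sC /C -!mulrA PP.
  apply: hfun_inj; have := dc i j ij (P u) (ex_intro _ (P u) (conj erefl (projection_in u))).
  by rewrite adjE !compE adjE.
by rewrite !(adjE, compE) -!aopM dc.
Qed.

End Compressions.
End Projection.
End Subspaces.

(** * Positive kernels *)

Section PositiveKernels.
Variable R : realType.
Local Notation C := R[i].

Definition vanishing (a : nat -> C) := forall e : R, 0 < e ->
  exists N : nat, forall n, (N <= n)%N -> `|a n| <= real_complex R e.

Lemma vanishing0 : vanishing (fun=> 0).
Proof. by move=> e e0; exists 0%N => n _; rewrite normr0 lecR ltW. Qed.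

Lemma vanishingD a b : vanishing a -> vanishing b ->
  vanishing (fun n => a n + b n).
Proof.
move=> aV bV e e0; have e2 : 0 < e / 2 by rewrite divr_gt0.
have [N aN] := aV _ e2; have [N' bN'] := bV _ e2; exists (maxn N N') => n.
rewrite geq_max => /andP[Nn N'n]; apply: le_trans (ler_normD _ _) _.
rewrite [e]splitr rmorphD /= lerD //; [exact: aN|exact: bN'].
Qed.

Lemma vanishingZ c a : vanishing a -> vanishing (fun n => c * a n).
Proof.
move=> aV e e0; pose r := complex.Re `|c|.
have r0 : 0 < r + 1 by rewrite ltr_wpDl ?Re_ge0.
have [N aN] := aV _ (divr_gt0 e0 r0); exists N => n /aN an.
have cE : `|c| = real_complex R r by rewrite -ge0_real.
apply: (@le_trans _ _ (real_complex R (r + 1) * real_complex R (e / (r + 1)))).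
  rewrite normrM; apply: ler_pM => //; by rewrite cE lecR lerDl.
by rewrite -rmorphM /= mulrC divfK ?gt_eqF.
Qed.

Lemma vanishing_sum I (r : seq I) (F : I -> nat -> C) :
  (forall i, vanishing (F i)) -> vanishing (fun n => \sum_(i <- r) F i n).
Proof.
move=> FV; elim: r => [|i r IH].
  by rewrite (_ : (fun n => _) = fun=> 0); [apply: vanishing0
    | apply/funext => n; rewrite big_nil].
rewrite (_ : (fun n => _) = fun n => F i n + \sum_(j <- r) F j n).
  exact: vanishingD.
by apply/funext => n; rewrite big_cons.
Qed.

Lemma vanishing_expr y : `|y| < 1 -> vanishing (fun n => y ^+ n).
Proof.
move=> y1 e e0; pose r := complex.Re `|y|.
have yE : `|y| = real_complex R r by rewrite -ge0_real.
have r1 : `|r| < 1.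
  by rewrite ger0_norm ?Re_ge0 // -ltcR -yE.
have [N _ rN] := cvgr0_norm_lt _ (cvg_expr r1) _ e0.
exists N => n Nn; rewrite normrX yE -rmorphXn /= lecR ltW //.
by apply: le_lt_trans (ler_norm _) (rN n Nn).
Qed.

Lemma ge0_approx (x : C) : (forall e : R, 0 < e ->
  exists z, 0 <= z /\ `|x - z| <= real_complex R e) -> 0 <= x.
Proof.
move=> xP.
have bound e : 0 < e -> - e <= complex.Re x /\ `|complex.Im x| <= e.
  move=> /xP[z [z0 xz]]; have zE := ge0_real z0.
  have := le_trans (normc_ge_Re (x - z)) xz; rewrite lecR ler_norml ReD ReN.
  have : `|'i%C * (x - z)| <= real_complex R e.
    by rewrite normrM normc_def /= expr0n /= expr1n add0r sqrtr1 mul1r.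
  move=> /(le_trans (normc_ge_Re _)); rewrite lecR -normrN -Im_ReNi.
  have -> : complex.Im (x - z) = complex.Im x.
    by rewrite zE; case: (x) => a b /=; rewrite oppr0 addr0.
  move=> -> /andP[zx _]; split=> //; have := Re_ge0 z0; lra.
rewrite lecE /=; apply/andP; split.
  apply/eqP/normr0_eq0/eqP; rewrite eq_le normr_ge0 andbT.
  by apply/ler_addgt0Pl => e /bound[]; rewrite addr0.
apply/ler_addgt0Pl => e /bound[+ _]; lra.
Qed.

Variable X : Type.
Implicit Types (L : X -> X -> C) (s : seq (C * X)).

Definition psd L := forall s, 0 <= \sum_(p <- s) \sum_(q <- s) p.1 * q.1^* * L q.2 p.2.

Lemma psd_eq L L' : (forall z w, L z w = L' z w) -> psd L -> psd L'.
Proof.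
by move=> LL' LP s; have := LP s; congr (0 <= _);
  apply: eq_bigr => p _; apply: eq_bigr => q _; rewrite LL'.
Qed.

Lemma psd_const1 : psd (fun _ _ => 1).
Proof.
move=> s; under eq_bigr do under eq_bigr do rewrite mulr1.
by rewrite -big_distrlr /= -rmorph_sum /= mul_conjC_ge0.
Qed.

Lemma psdD L L' : psd L -> psd L' -> psd (fun z w => L z w + L' z w).
Proof.
move=> LP LP' s; under eq_bigr do (under eq_bigr do rewrite mulrDr; rewrite big_split).
by rewrite big_split addr_ge0 ?LP ?LP'.
Qed.

Lemma psdZ L a : 0 <= a -> psd L -> psd (fun z w => a * L z w).
Proof.
move=> a0 LP s.
under eq_bigr do (under eq_bigr do rewrite mulrCA; rewrite -mulr_sumr).
by rewrite -mulr_sumr mulr_ge0 ?LP.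
Qed.

Lemma psd_conj L g : psd L -> psd (fun z w => g z * (g w)^* * L z w).
Proof.
move=> LP s; have := LP [seq (p.1 * (g p.2)^*, p.2) | p <- s].
rewrite big_map; congr (0 <= _); apply: eq_bigr => p _; rewrite big_map.
apply: eq_bigr => q _ /=; rewrite rmorphM /= conjCK; ring.
Qed.

Lemma psd_sum (L : nat -> X -> X -> C) k : (forall j, psd (L j)) ->
  psd (fun z w => \sum_(j < k) L j z w).
Proof.
move=> LP; elim: k => [|k IH].
  by apply: psd_eq (psdZ (lexx 0) psd_const1) => z w; rewrite mul0r big_ord0.
by apply: psd_eq (psdD IH (LP k)) => z w; rewrite big_ord_recr.
Qed.

(** The geometric series writes the left-hand side as a limit of sums of the
    positive kernels [c(z)^k conj(c(w))^k L(z,w)]. *)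
Lemma psd_szego L (c : X -> C) : (forall x, `|c x| < 1) -> psd L ->
  psd (fun z w => (1 - c z * (c w)^*)^-1 * L z w).
Proof.
move=> c1 LP s; apply: ge0_approx => e e0.
have y1 z w : `|c z * (c w)^*| < 1.
  by rewrite normrM norm_conjC mulr_ilt1.
have : vanishing (fun k => \sum_(p <- s) \sum_(q <- s)
    p.1 * q.1^* * ((1 - c q.2 * (c p.2)^*)^-1 * L q.2 p.2) * (c q.2 * (c p.2)^*) ^+ k).
  apply: vanishing_sum => p; apply: vanishing_sum => q.
  by apply: vanishingZ; apply: vanishing_expr.
move=> /(_ e e0)[k /(_ k (leqnn k)) ke].
exists (\sum_(p <- s) \sum_(q <- s) p.1 * q.1^* *
  \sum_(j < k) (c q.2 ^+ j * (c p.2 ^+ j)^* * L q.2 p.2)); split.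
  apply: (@psd_sum (fun j z w => c z ^+ j * (c w ^+ j)^* * L z w)) => j.
  exact: (psd_conj (fun x => c x ^+ j) LP).
apply: le_trans ke; rewrite le_eqVlt; apply/orP; left; apply/eqP; congr `|_|.
rewrite -sumrB; apply: eq_bigr => p _; rewrite -sumrB; apply: eq_bigr => q _.
have n0 : 1 - c q.2 * (c p.2)^* != 0.
  apply/negP => /eqP/subr0_eq E.
  by have := y1 q.2 p.2; rewrite -E normr1 ltxx.
have -> : \sum_(j < k) c q.2 ^+ j * (c p.2 ^+ j)^* * L q.2 p.2 =
    (1 - (c q.2 * (c p.2)^*) ^+ k) / (1 - c q.2 * (c p.2)^*) * L q.2 p.2.
  rewrite -mulr_suml; congr (_ * _).
  rewrite -[X in X - _ ^+ k](expr1n _ k) subrXX mulrAC divff // mul1r.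
  by apply: eq_bigr => j _; rewrite expr1n mul1r exprMn rmorphXn.
by field.
Qed.

Lemma psd_szegoX L (c : X -> C) m : (forall x, `|c x| < 1) -> psd L ->
  psd (fun z w => (1 - c z * (c w)^*)^-1 ^+ m * L z w).
Proof.
move=> c1 LP; elim: m => [|m IH].
  by apply: psd_eq LP => z w; rewrite expr0 mul1r.
by apply: psd_eq (psd_szego c1 IH) => z w; rewrite exprS -mulrA.
Qed.

End PositiveKernels.

Lemma psd_comp (R : realType) (X Y : Type) (L : Y -> Y -> R[i]) (f : X -> Y) :
  psd L -> psd (fun z w => L (f z) (f w)).
Proof.
move=> LP s; have := LP [seq (p.1, f p.2) | p <- s].
by rewrite big_map; under eq_bigr do rewrite big_map.
Qed.

(** * Reproducing kernel spaces *)

Section ReproducingKernel.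
Variables (R : realType) (X : Type) (H : hilbert_fun_space R X).
Variable K : X -> X -> R[i].
Hypothesis HK : reproducing_kernel H K.
Implicit Types (u v : hsp H).

Definition kerf w : hsp H := Hsp (HK.1 w).

Lemma evalE u w : u w = ip u (kerf w).
Proof. exact: HK.2 (hfunP u). Qed.

Lemma ip_kerf u w : ip (kerf w) u = (u w)^*.
Proof. by rewrite evalE -ipC. Qed.

Definition kspan (s : seq (R[i] * X)) : hsp H := \sum_(p <- s) p.1 *: kerf p.2.

Lemma ip_kspan_l s u : ip (kspan s) u = \sum_(p <- s) p.1 * (u p.2)^*.
Proof. by rewrite ip_suml; apply: eq_bigr => p _; rewrite ipZl ip_kerf. Qed.

Lemma ip_kspan s : ip (kspan s) (kspan s) =
  \sum_(p <- s) \sum_(q <- s) p.1 * q.1^* * K q.2 p.2.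
Proof.
rewrite ip_kspan_l; apply: eq_bigr => p _.
rewrite hsp_sum rmorph_sum mulr_sumr; apply: eq_bigr => q _.
rewrite hspZ rmorphM mulrA; congr (_ * _).
by apply: etrans (esym (ip_kerf _ _)) _; rewrite -evalE.
Qed.

Lemma kspan_form (b : R) h s :
  \sum_(p <- s) \sum_(q <- s)
     p.1 * q.1^* * (real_complex R b * K q.2 p.2 - h q.2 * (h p.2)^*) =
  real_complex R (b * nrm (kspan s) ^+ 2
    - (complex.Re (\sum_(p <- s) p.1 * (h p.2)^*) ^+ 2
       + complex.Im (\sum_(p <- s) p.1 * (h p.2)^*) ^+ 2)).
Proof.
set t := \sum_(p <- s) p.1 * _.
rewrite rmorphB rmorphM /= -ip_nrm add_Re2_Im2 normCK ip_kspan mulr_sumr.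
have -> : t * t^* = \sum_(p <- s) \sum_(q <- s) p.1 * (h p.2)^* * (q.1^* * h q.2).
  rewrite /t rmorph_sum /= big_distrlr; apply: eq_bigr => p _; apply: eq_bigr => q _.
  by rewrite rmorphM /= conjCK.
rewrite -sumrB; apply: eq_bigr => p _; rewrite mulr_sumr -sumrB.
apply: eq_bigr => q _; ring.
Qed.

(** Positivity says that the functional [K(., w) |-> conj (h w)] has norm at most
    [b] on combinations of kernel functions; the vector representing it takes
    the values of [h]. *)
Lemma psd_member (b : R) h : 0 <= b ->
  psd (fun z w => real_complex R (b ^+ 2) * K z w - h z * (h w)^*) ->
  exists u : hsp H, hfun u = h /\ nrm u <= b.
Proof.
move=> b0 hP.
have [||||u [uP ub _]] := @riesz _ _ H (fun v t => exists s, v = kspan s /\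
    t = \sum_(p <- s) p.1 * (h p.2)^*) b.
- exact: b0.
- by exists [::]; rewrite /kspan !big_nil.
- move=> a _ _ _ _ [s [-> ->]] [s' [-> ->]].
  exists ([seq (a * p.1, p.2) | p <- s] ++ s'); rewrite /kspan !big_cat !big_map /=.
  rewrite scaler_sumr mulr_sumr; split; congr (_ + _); apply: eq_bigr => p _.
    by rewrite scalerA.
  by rewrite mulrA.
- move=> _ _ [s [-> ->]]; set t := \sum_(p <- s) _.
  have := hP s; rewrite kspan_form -/t ler0c => ts.
  apply: le_trans (ler_norm _) _.
  rewrite -ler_sqr ?nnegrE ?mulr_ge0 ?nrm_ge0 // real_normK ?num_real // exprMn.
  have := sqr_ge0 (complex.Im t); lra.
exists u; split=> //; apply/funext => w.
rewrite evalE ipC -(uP _ (h w)^*) ?conjCK //.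
by exists [:: (1, w)]; rewrite /kspan !big_seq1 scale1r mul1r.
Qed.

Lemma member_psd u :
  psd (fun z w => real_complex R (nrm u ^+ 2) * K z w - u z * (u w)^*).
Proof.
move=> s; rewrite kspan_form -ip_kspan_l ler0c subr_ge0 mulrC.
exact: ip_le_sqr.
Qed.

Lemma kerf_total u : (forall w, ip u (kerf w) = 0) -> u = 0.
Proof. by move=> u0; apply: hspP => w; rewrite evalE u0. Qed.

(** For [g = c u], the kernel [|u|^2 K - g (conj g)] is the sum of
    [|u|^2 (1 - c (conj c)) K] and [c (conj c) (|u|^2 K - u (conj u))], both
    positive. *)
Lemma contractive_multiplier (c : X -> R[i]) :
  psd (fun z w => (1 - c z * (c w)^*) * K z w) ->
  exists M : adjop H, contraction M /\ forall u x, (M u) x = c x * u x.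
Proof.
move=> cP.
suff /choice[m mP] : forall u, exists v : hsp H,
    hfun v = (fun x => c x * u x) /\ nrm v <= nrm u.
  have mE u x : m u x = c x * u x by rewrite (mP _).1.
  have [a u v|u|M ME] := @bounded_adjop _ _ H m 1 ler01.
  - by apply: hspP => x; rewrite !(hspD, hspZ, mE); ring.
  - by rewrite mul1r; apply: (mP u).2.
  by exists M; split=> [u|u x]; rewrite ME; [apply: (mP u).2|apply: mE].
move=> u; apply: psd_member; first exact: nrm_ge0.
have n0 : 0 <= real_complex R (nrm u ^+ 2) by rewrite ler0c sqr_ge0.
apply: psd_eq (psdD (psdZ n0 cP) (psd_conj c (member_psd u))) => z w.
by rewrite rmorphM /=; ring.
Qed.

End ReproducingKernel.

(** * Products of commuting families *)

Section OrderedProducts.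
Variable A : pzRingType.
Implicit Types (x y z : A).

Lemma comm_inverse x y z : y * z = 1 -> z * y = 1 -> GRing.comm x y -> GRing.comm x z.
Proof.
move=> yz zy xy; rewrite /GRing.comm -[x * z]mul1r -zy -mulrA (mulrA y) -xy.
by rewrite -!mulrA yz mulr1.
Qed.

Lemma prod_mul_comm (I : eqType) (s : seq I) (F G : I -> A) : uniq s ->
  (forall i j, i != j -> GRing.comm (F i) (G j)) ->
  (\prod_(i <- s) F i) * (\prod_(i <- s) G i) = \prod_(i <- s) (F i * G i).
Proof.
move=> + FG; elim: s => [|i s IH] /=; first by rewrite !big_nil mulr1.
move=> /andP[si us]; rewrite !big_cons -IH // -!mulrA; congr (_ * _).
rewrite !mulrA; congr (_ * _); apply: commr_sym.
rewrite big_seq; apply: commr_prod => j js; apply: commr_sym; apply: FG.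
by apply: contraNneq si => <-.
Qed.

Lemma prod_intertwine (I : Type) (s : seq I) (F G : I -> A) p :
  (forall i, F i * p = p * G i) ->
  (\prod_(i <- s) F i) * p = p * \prod_(i <- s) G i.
Proof.
move=> FG; elim: s => [|i s IH]; first by rewrite !big_nil mul1r mulr1.
by rewrite !big_cons -mulrA IH mulrA FG mulrA.
Qed.

Lemma exp_intertwine x y p k : x * p = p * y -> x ^+ k * p = p * y ^+ k.
Proof.
move=> xy; elim: k => [|k IH]; first by rewrite !expr0 mul1r mulr1.
by rewrite exprS -mulrA IH mulrA xy -mulrA -exprS.
Qed.

End OrderedProducts.

(** * Defect operators *)

Section Defects.
Variables (R : realType) (X : Type) (H : hilbert_fun_space R X).
Implicit Types (P C M T Y Z : adjop H).

(** Iterating [k] times on [Y = 1] gives the hereditary polynomial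
    [(1 - z conj w)^k] evaluated at [C], in the form best suited to induction. *)
Definition defect C Y : adjop H := Y - C * Y * star C.

Lemma comm_defect T C Y k : GRing.comm T C -> GRing.comm T (star C) ->
  GRing.comm T Y -> GRing.comm T (iter k (defect C) Y).
Proof.
by move=> TC TC' TY; elim: k => //= k IH; do ?[apply: commrB | apply: commrM].
Qed.

Lemma defect_mulr C Z Y k : GRing.comm Y (star C) ->
  iter k (defect C) (Z * Y) = iter k (defect C) Z * Y.
Proof.
move=> YC; elim: k => //= k ->.
by rewrite /defect mulrBl -!mulrA YC.
Qed.

Lemma star_defect C Y k : star Y = Y -> star (iter k (defect C) Y) = iter k (defect C) Y.
Proof.
by move=> sY; elim: k => //= k IH; rewrite starB !starM starK IH mulrA.
Qed.

(** A submodule is invariant under [M], so compressing to its complement is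
    compatible with [M _ M^*] and turns defects of [M] into defects of the
    compression. *)
Lemma compress_defect P M Y k : star P = P -> P * P = P -> P * M = P * M * P ->
  P * iter k (defect M) Y * P = iter k (defect (P * M * P)) (P * Y * P).
Proof.
move=> sP PP PM; elim: k => //= k <-; set Z := iter _ _ Y.
have MP : star M * P = P * star M * P.
  by have := congr1 (@star _ _ H) PM; rewrite !starM sP mulrA.
rewrite /defect !starM sP mulrBr mulrBl; congr (_ - _).
transitivity (P * M * P * Z * (P * star M * P)); first by rewrite -PM -MP !mulrA.
by rewrite !mulrA -!(mulrA _ P P) !PP.
Qed.

End Defects.

(** * The projected kernel is a product *)

Section Factorization.
Variables (R : realType) (X : Type) (H : hilbert_fun_space R X).
Variables (K : X -> X -> R[i]) (HK : reproducing_kernel H K).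
Variables (n : nat) (coord : 'I_n -> X -> R[i]) (m : 'I_n -> nat) (o : X).
Hypothesis coord_lt1 : forall i x, `|coord i x| < 1.
Hypothesis coord_o : forall i, coord i o = 0.
Hypothesis KE : forall z w,
  \prod_(i < n) (1 - coord i z * (coord i w)^*) ^+ m i * K z w = 1.
Variable M : 'I_n -> adjop H.
Hypothesis Mc : forall i, contraction (M i).
Hypothesis ME : forall i u x, (M i u) x = coord i x * u x.
Variable P : adjop H.
Hypotheses (sP : star P = P) (PP : P * P = P) (PM : forall i, P * M i = P * M i * P).

Let C i := P * M i * P.
Hypothesis dc : forall i j : 'I_n, (i < j)%N -> GRing.comm (C i) (star (C j)).

Local Notation k := (kerf HK).
Let e := P (k o).
Let D i := iter (m i) (defect (C i)) P.

Lemma kernel_origin x : k o x = 1.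
Proof.
rewrite -[RHS](KE x o) big1 ?mul1r // => i _.
by rewrite coord_o conjC0 mulr0 subr0 expr1n.
Qed.

Lemma star_mul_kerf i w : star (M i) (k w) = (coord i w)^* *: k w.
Proof.
by apply: ip_injr => v; rewrite -starP ipZr conjCK -!(evalE HK) ME.
Qed.

Lemma commPC i : GRing.comm P (C i).
Proof. by rewrite /GRing.comm /C !mulrA PP -(mulrA _ P P) PP. Qed.

Lemma commPsC i : GRing.comm P (star (C i)).
Proof. by rewrite -[P in GRing.comm P _]sP; apply: comm_star; apply: commPC. Qed.

Lemma commCC i j : GRing.comm (C i) (C j).
Proof.
have CC a b : C a * C b = P * (M a * M b) * P.
  by rewrite /C !mulrA -(mulrA _ P P) PP -PM.
rewrite /GRing.comm !CC; congr (_ * _ * _).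
by apply: adjopP => u; apply: hspP => x; rewrite !aopM !ME mulrCA.
Qed.

Lemma commCsC i j : i != j -> GRing.comm (C i) (star (C j)).
Proof.
move=> ij; have [lt_ij|lt_ji|eq_ij] := ltngtP i j; first exact: dc.
  by rewrite -[C i]starK; apply: comm_star; apply: commr_sym; apply: dc.
by rewrite (ord_inj eq_ij) eqxx in ij.
Qed.

Lemma comm_defect_op T i : GRing.comm T P -> GRing.comm T (C i) ->
  GRing.comm T (star (C i)) -> GRing.comm T (D i).
Proof. by move=> TP TC TC'; apply: comm_defect. Qed.

Lemma commPD i : GRing.comm P (D i).
Proof.
by apply: comm_defect_op; [apply: commr_refl|apply: commPC|apply: commPsC].
Qed.

Lemma commDC i j : i != j -> GRing.comm (D i) (C j) /\ GRing.comm (D i) (star (C j)).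
Proof.
move=> ij; split; apply: commr_sym; apply: comm_defect_op.
- exact/commr_sym/commPC.
- exact: commCC.
- by apply: commCsC; rewrite eq_sym.
- exact/commr_sym/commPsC.
- by apply: commr_sym; apply: commCsC.
- by apply: comm_star; apply: commCC.
Qed.

Lemma commDD i j : GRing.comm (D i) (D j).
Proof.
have [->|ij] := eqVneq i j; first exact: commr_refl.
have [DC DC'] := commDC ij.
by apply: comm_defect_op => //; apply/commr_sym/commPD.
Qed.

Definition iter_defect (c : 'I_n -> adjop H) Y (s : seq 'I_n) :=
  foldr (fun i => iter (m i) (defect (c i))) Y s.

(** Double commutation enters here: it allows each defect to be taken around
    the product of the following ones. *)
Lemma prod_defects s : uniq s -> (\prod_(i <- s) D i) * P = iter_defect C P s.
Proof.
elim: s => [|i s IH] /=; first by rewrite big_nil mul1r.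
move=> /andP[si us]; rewrite big_cons -mulrA -(IH us); set Y := _ * P.
have PY : P * Y = Y.
  rewrite /Y mulrA (_ : P * _ = \prod_(j <- s) D j * P) -?mulrA ?PP //.
  by apply: commr_prod => j _; apply: commPD.
rewrite -[in RHS]PY defect_mulr //.
apply: commr_sym; apply: commrM; last exact/commr_sym/commPsC.
rewrite big_seq; apply: commr_prod => j js; apply: commr_sym.
by apply: (commDC _).2; apply: contraNneq si => <-.
Qed.

Lemma compress_iter_defect s : P * iter_defect M 1 s * P = iter_defect C P s.
Proof.
elim: s => [|i s IH] /=; first by rewrite mulr1.
by rewrite compress_defect // IH.
Qed.

Lemma star_iter_defect s : star (iter_defect M 1 s) = iter_defect M 1 s.
Proof. by elim: s => [|i s IH] /=; rewrite ?star1 // star_defect. Qed.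

Lemma ip_defect_kerf i Y j z w :
  ip (iter j (defect (M i)) Y (k w)) (k z) =
  (1 - coord i z * (coord i w)^*) ^+ j * ip (Y (k w)) (k z).
Proof.
elim: j => [|j IH]; first by rewrite mul1r.
rewrite iterS /defect aopB ipBl !aopM star_mul_kerf !aopZ ipZl.
by rewrite -(evalE HK (M i _)) ME (evalE HK) IH exprS; ring.
Qed.

Lemma ip_iter_defect_kerf s z w : ip (iter_defect M 1 s (k w)) (k z) =
  \prod_(i <- s) (1 - coord i z * (coord i w)^*) ^+ m i * K z w.
Proof.
elim: s => [|i s IH]; first by rewrite big_nil mul1r aop1 -(evalE HK).
by rewrite /= ip_defect_kerf IH big_cons mulrA.
Qed.

(** On kernel functions the iterated defect of the multiplications multiplies
    [K] by its reciprocal polynomial, leaving the constant [1]: it is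
    [f |-> f(o) 1], whose compression is [f |-> <f, e> e]. *)
Lemma prod_defects_rank1 f : P f = f -> (\prod_(i < n) D i) f = ip f e *: e.
Proof.
move=> Pf; rewrite -{1}Pf -aopM prod_defects ?index_enum_uniq //.
rewrite -compress_iter_defect !aopM Pf; set Z := iter_defect M 1 _.
have Zk w : Z (k w) = k o.
  apply: hspP => z; rewrite (evalE HK) ip_iter_defect_kerf KE kernel_origin //.
have -> : Z f = ip f (k o) *: k o.
  apply: hspP => z; rewrite (evalE HK) starP star_iter_defect Zk hspZ.
  by rewrite kernel_origin mulr1.
by rewrite aopZ -{1}Pf starP sP.
Qed.

Lemma prod_eigen (F : 'I_n -> adjop H) (l : 'I_n -> R[i]) v s :
  (forall i, F i v = l i *: v) ->
  (\prod_(i <- s) F i) v = (\prod_(i <- s) l i) *: v.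
Proof.
move=> Fv; elim: s => [|i s IH]; first by rewrite !big_nil aop1 scale1r.
by rewrite !big_cons aopM IH aopZ Fv scalerA mulrC.
Qed.

Lemma contractionC i : contraction (C i).
Proof.
have Pc := star_projection_contraction sP PP.
by apply: contractionM => //; apply: contractionM.
Qed.

Lemma P_e : P e = e.
Proof. by rewrite /e -aopM PP. Qed.

Lemma coord_conj_lt1 i z : `|(coord i z)^*| < 1.
Proof. by rewrite norm_conjC. Qed.

Section Resolvents.
Variable r : 'I_n -> R[i] -> adjop H.
Hypothesis rP : forall i a, `|a| < 1 ->
  r i a * (1 - adj_scale H a * C i) = 1 /\ (1 - adj_scale H a * C i) * r i a = 1.

Lemma comm_resolventX T i a : `|a| < 1 -> GRing.comm T (C i) ->
  GRing.comm T (r i a ^+ m i).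
Proof.
move=> /(rP i)[rl rr] TC; apply: commrX; apply: (comm_inverse rr rl).
apply: commrB; first exact: commr1.
by apply: commrM => //; apply: comm_scale.
Qed.

(** The factors [1 - conj (w_i) C_i] turn [P k_w] into [e], because the
    corresponding multiplications turn [k_w] into the constant [1]. *)
Lemma kernel_orbit w : P (k w) = (\prod_(i < n) r i (coord i w)^* ^+ m i) e.
Proof.
pose B i := (1 - adj_scale H (coord i w)^* * C i) ^+ m i.
pose N i := (1 - adj_scale H (coord i w)^* * M i) ^+ m i.
have BN i : B i * P = P * N i.
  apply: exp_intertwine; rewrite mulrBl mul1r mulrBr mulr1; congr (_ - _).
  rewrite [RHS]mulrA comm_scale -!mulrA; congr (_ * _).
  by rewrite PP [P * (M i * P)]mulrA -PM.
have Nx i u x : (N i u) x = (1 - coord i x * (coord i w)^*) ^+ m i * u x.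
  rewrite /N; elim: (m i) u => [|j IH] u; first by rewrite expr0 aop1 mul1r.
  rewrite exprSr aopM IH aopB aop1 aopM aop_scale hspB hspZ ME exprSr; ring.
have Nprod s u x : ((\prod_(i <- s) N i) u) x =
    \prod_(i <- s) (1 - coord i x * (coord i w)^*) ^+ m i * u x.
  elim: s => [|i s IH]; first by rewrite !big_nil aop1 mul1r.
  by rewrite !big_cons aopM Nx IH mulrA.
have -> : e = (\prod_(i < n) B i) (P (k w)).
  rewrite -aopM (prod_intertwine _ BN) aopM /e; congr (P _).
  by apply: hspP => x; rewrite Nprod KE kernel_origin.
rewrite -aopM prod_mul_comm ?index_enum_uniq //.
  rewrite big1 ?aop1 // => i _; have [rl rr] := rP i (coord_conj_lt1 i w).
  by rewrite /B -exprMn_comm ?rl ?expr1n // /GRing.comm rl rr.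
move=> i j _; apply/commr_sym/comm_resolventX; first exact: coord_conj_lt1.
  apply: commr_sym; apply: commrX.
apply: commrB; first exact: commr1.
by apply: commrM; [apply: comm_scale|apply: commCC].
Qed.

End Resolvents.

Lemma resolvents_exist : exists r : 'I_n -> R[i] -> adjop H, forall i a, `|a| < 1 ->
  r i a * (1 - adj_scale H a * C i) = 1 /\ (1 - adj_scale H a * C i) * r i a = 1.
Proof.
suff /choice[r rP] : forall ia : 'I_n * R[i], exists S : adjop H, `|ia.2| < 1 ->
    S * (1 - adj_scale H ia.2 * C ia.1) = 1 /\
    (1 - adj_scale H ia.2 * C ia.1) * S = 1.
  by exists (fun i a => r (i, a)) => i a /(rP (i, a)).
move=> [i a] /=; have [a1|_] := boolP (`|a| < 1); last by exists 0.
by have [S SP] := resolvent (contractionC i) a1; exists S.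
Qed.

Section NonZero.
Hypothesis e_neq0 : e != 0.

Lemma ip_ee_neq0 : ip e e != 0.
Proof. by apply: contra_neq e_neq0 => /ip_eq0. Qed.

(** [D i] commutes with [f |-> <f, e> e], so it preserves the line of [e]. *)
Lemma defect_eigen i : D i e = (ip (D i e) e / ip e e) *: e.
Proof.
have DP : P (D i e) = D i e by rewrite -aopM commPD aopM P_e.
have := prod_defects_rank1 DP; rewrite -aopM.
have <- : D i * \prod_(j < n) D j = \prod_(j < n) D j * D i.
  by apply: commr_prod => j _; apply: commDD.
rewrite aopM (prod_defects_rank1 P_e) aopZ => DE.
by rewrite mulrC -scalerA -DE scalerA mulVf ?scale1r // ip_ee_neq0.
Qed.

Let l i := ip (D i e) e / ip e e.

Lemma prod_eigenvalues : \prod_(i < n) l i = ip e e.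
Proof.
have := prod_defects_rank1 P_e; rewrite (prod_eigen _ defect_eigen) => /eqP.
by rewrite -subr_eq0 -scalerBl scaler_eq0 (negPf e_neq0) orbF subr_eq0 => /eqP.
Qed.

Lemma eigenvalue_neq0 i : l i != 0.
Proof.
have : \prod_(i < n) l i != 0 by rewrite prod_eigenvalues ip_ee_neq0.
by move=> /prodf_neq0/(_ i isT).
Qed.

(** On vectors [T e], with [T] commuting with the other defects, the remaining
    [D j] act as scalars, so [D i] alone has to project onto the line of [e]. *)
Lemma defect_vacuum i T : GRing.comm T P ->
  (forall j, j != i -> GRing.comm T (D j)) ->
  D i (T e) = (ip (T e) e / \prod_(j < n | j != i) l j) *: e.
Proof.
move=> TP TD; pose E j := if j == i then 1 else D j.
have PT : P (T e) = T e by rewrite -aopM -TP aopM P_e.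
have prodE : \prod_(j < n) D j = D i * \prod_(j < n) E j.
  have -> : D i = \prod_(j < n) (if j == i then D j else 1).
    by rewrite -big_mkcond big_pred1_eq.
  rewrite prod_mul_comm ?index_enum_uniq //.
    by apply: eq_bigr => j _; rewrite /E; case: eqP => _; rewrite ?mulr1 ?mul1r.
  move=> a b _; rewrite /E; case: eqP => _; case: eqP => _.
  - exact: commr1.
  - exact: commDD.
  - exact: commr1.
  - exact/commr_sym/commr1.
have TE : GRing.comm T (\prod_(j < n) E j).
  apply: commr_prod => j _; rewrite /E; case: eqP => [_|/eqP ji]; first exact: commr1.
  exact: TD.
have Ee j : E j e = (if j == i then 1 else l j) *: e.
  by rewrite /E; case: eqP => _; [rewrite aop1 scale1r|exact: defect_eigen].
have l0 : \prod_(j < n | j != i) l j != 0.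
  by apply/prodf_neq0 => j _; apply: eigenvalue_neq0.
have := prod_defects_rank1 PT; rewrite prodE aopM -(aopM _ T) -TE aopM.
rewrite (prod_eigen _ Ee) !aopZ.
have -> : \prod_(j < n) (if j == i then 1 else l j) = \prod_(j < n | j != i) l j.
  by rewrite [RHS]big_mkcond; apply: eq_bigr => j _; case: eqP.
by move=> DE; rewrite mulrC -scalerA -DE scalerA mulVf // scale1r.
Qed.

(** Since [P k_w] is the product of the resolvent powers [F w i] applied to [e],
    the number [(P k_w)(z)] is [<X_1 ... X_n e, e>] with
    [X_i = (F z i)^* (F w i)].  Moving the defects next to the [X_i] splits it
    into the product of the scalars by which [D_i X_i] acts on [e]. *)
Lemma kernel_factorization_neq0 : exists mu : 'I_n -> R[i] -> R[i] -> R[i],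
  forall z w, (P (k w)) z = \prod_(i < n) mu i (coord i z) (coord i w).
Proof.
have [r rP] := resolvents_exist.
have comm_r T i a : `|a| < 1 -> GRing.comm T (C i) -> GRing.comm T (r i a ^+ m i).
  by move=> a1 TC; apply: (comm_resolventX rP a1 TC).
have a1 := coord_conj_lt1.
pose F w i := r i (coord i w)^* ^+ m i.
have kF w : P (k w) = (\prod_(i < n) F w i) e by exact: kernel_orbit rP w.
pose Y z w i := star (F z i) * F w i.
have FC z i j : GRing.comm (F z i) (C j) by apply/commr_sym/comm_r => //; apply: commCC.
have FsC z i j : i != j -> GRing.comm (F z i) (star (C j)).
  move=> ij; apply/commr_sym/comm_r => //; apply: commr_sym; exact: commCsC.
have FP z i : GRing.comm (F z i) P.
  by apply/commr_sym/comm_r => //; apply: commPC.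
have sFP z i : GRing.comm (star (F z i)) P.
  by rewrite -sP; apply: comm_star.
have sFC z i j : i != j -> GRing.comm (star (F z i)) (C j).
  by move=> ij; rewrite -[C j]starK; apply: comm_star; apply: FsC.
have YD z w i j : j != i -> GRing.comm (Y z w i) (D j).
  move=> ji; have ij : i != j by rewrite eq_sym.
  apply: comm_defect_op; apply: commr_sym; apply: commrM; apply: commr_sym.
  - exact: sFP.
  - exact: FP.
  - exact: sFC.
  - exact: FC.
  - exact/comm_star/FC.
  - exact: FsC.
have starF z s : star (\prod_(i <- s) F z i) = \prod_(i <- s) star (F z i).
  elim: s => [|i s IH]; first by rewrite !big_nil star1.
  rewrite !big_cons starM IH; apply: commr_sym; apply: commr_prod => j _.
  by apply: comm_star; apply: comm_r => //; apply: FC.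
exists (fun i a b => ip ((star (r i a^* ^+ m i) * (r i b^* ^+ m i)) e) e
                     / \prod_(j < n | j != i) l j) => z w.
have -> : (P (k w)) z = ip ((\prod_(i < n) Y z w i) e) e.
  rewrite (evalE HK) -{1}PP aopM starP sP !kF.
  rewrite -prod_mul_comm ?index_enum_uniq //; last first.
    by move=> i j ij; apply: comm_r => //; apply: sFC.
  by rewrite -starF aopM [RHS]starP starK.
have YP i : GRing.comm (Y z w i) P.
  by apply: commr_sym; apply: commrM; apply: commr_sym; [apply: sFP|apply: FP].
have Ye : P ((\prod_(i < n) Y z w i) e) = (\prod_(i < n) Y z w i) e.
  rewrite -aopM (_ : P * _ = (\prod_(i < n) Y z w i) * P) ?aopM ?P_e //.
  by apply: commr_prod => i _; apply/commr_sym/YP.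
have := prod_defects_rank1 Ye; rewrite -aopM prod_mul_comm ?index_enum_uniq //; last first.
  by move=> i j ij; apply: commr_sym; apply: YD.
have DY i : (D i * Y z w i) e = (ip (Y z w i e) e / \prod_(j < n | j != i) l j) *: e.
  by rewrite aopM defect_vacuum // => j ji; apply: YD.
rewrite (prod_eigen _ DY) => /eqP.
by rewrite -subr_eq0 -scalerBl scaler_eq0 (negPf e_neq0) orbF subr_eq0 => /eqP <-.
Qed.

End NonZero.

(** By [kernel_orbit], [e = 0] only when [P = 0]; this is the first case. *)
Lemma kernel_factorization :
  (forall w, P (k w) = 0) \/
  (P (k o)) o != 0 /\ exists mu : 'I_n -> R[i] -> R[i] -> R[i],
    forall z w, (P (k w)) z = \prod_(i < n) mu i (coord i z) (coord i w).
Proof.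
have [e0|e0] := eqVneq e 0; [left => w|right; split].
- have [r rP] := resolvents_exist.
  by rewrite (kernel_orbit rP) e0 aop_0.
- by rewrite (evalE HK) -{1}PP aopM starP sP ip_ee_neq0.
- exact: kernel_factorization_neq0.
Qed.

End Factorization.

(** * Kernels of the disc *)

Section DiscKernel.
Variable R : realType.

Definition kernel_order (a : int) : nat := `|(a + 2)%R|%N.

Lemma disc_kernelE (a : int) (z w : disc R) : -1 < a ->
  disc_kernel a z w = (1 - val z * (val w)^*)^-1 ^+ kernel_order a.
Proof.
move=> a1; have a2 : 0 <= a + 2 by lra.
by rewrite /disc_kernel -{1}(gez0_abs a2) -invr_expz exprVn.
Qed.

Lemma kernel_order_gt0 (a : int) : -1 < a -> (0 < kernel_order a)%N.
Proof. by move=> a1; rewrite absz_gt0 gt_eqF //; lra. Qed.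

Lemma disc_lt1 (z : disc R) : `|val z| < 1.
Proof. exact: (valP z). Qed.

Fact disc0_subproof : `|0 : R[i]| < 1.
Proof. by rewrite normr0 ltr01. Qed.

Definition disc0 : disc R := exist _ 0 disc0_subproof.

Lemma one_sub_neq0 (z w : disc R) : 1 - val z * (val w)^* != 0.
Proof.
apply/negP => /eqP/subr0_eq E.
have : `|val z * (val w)^*| < 1.
  by rewrite normrM norm_conjC mulr_ilt1 ?disc_lt1.
by rewrite -E normr1 ltxx.
Qed.

(** Positivity of product kernels is obtained by multiplying by one disc kernel
    at a time, each a power of the kernel treated by the geometric series. *)
Lemma psd_disc_kernel X (f : X -> disc R) (a : int) L : -1 < a -> psd L ->
  psd (fun z w => disc_kernel a (f z) (f w) * L z w).
Proof.
move=> a1 LP.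
apply: psd_eq (psd_szegoX (c := fun x => val (f x)) (kernel_order a) _ LP) => [z w|x].
  by rewrite disc_kernelE.
exact: disc_lt1.
Qed.

Lemma psd_disc_kernel_sub X (f : X -> disc R) (a : int) L : -1 < a -> psd L ->
  psd (fun z w => (1 - val (f z) * (val (f w))^*) *
                  (disc_kernel a (f z) (f w) * L z w)).
Proof.
move=> a1 LP.
apply: psd_eq (psd_szegoX (c := fun x => val (f x)) (kernel_order a).-1 _ LP) => [z w|x].
  rewrite disc_kernelE // -[in RHS](prednK (kernel_order_gt0 a1)) exprS.
  by rewrite !mulrA mulfV ?mul1r // one_sub_neq0.
exact: disc_lt1.
Qed.

End DiscKernel.

(** * Pure tensors *)

Section Tensors.
Variables (R : realType) (n : nat) (alpha : 'I_n -> int).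
Variables (H : hilbert_fun_space R (polydisc R n)).
Variable A : 'I_n -> hilbert_fun_space R (disc R).
Hypothesis alpha_gt : forall i, -1 < alpha i.
Hypothesis HK : reproducing_kernel H (polydisc_kernel alpha).
Hypothesis AK : forall i, reproducing_kernel (A i) (disc_kernel (alpha i)).

Local Notation put := eqtype.dfwith.
Local Notation vecs := (forall i, hsp (A i)).
Implicit Types (F G : vecs).

Lemma coordinate_multipliers : exists M : 'I_n -> adjop H,
  (forall i, contraction (M i)) /\ forall i u z, (M i u) z = val (z i) * u z.
Proof.
suff /choice[M MP] : forall i, exists M : adjop H, contraction M /\
    forall u z, (M u) z = val (z i) * u z.
  by exists M; split=> i; case: (MP i).
move=> i; apply: (contractive_multiplier HK (c := fun z => val (z i))).
have : psd (fun z w : polydisc R n =>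
    \prod_(j < n | j != i) disc_kernel (alpha j) (z j) (w j)).
  elim: (index_enum _) => [|j s IH].
    by apply: psd_eq (@psd_const1 _ _) => z w; rewrite big_nil.
  have [ji|ji] := boolP (j != i); last first.
    by apply: psd_eq IH => z w; rewrite big_cons (negPf ji).
  apply: psd_eq (psd_disc_kernel (fun z : polydisc R n => z j) (alpha_gt j) IH) => z w.
  by rewrite big_cons ji.
move=> /(psd_disc_kernel_sub (fun z : polydisc R n => z i) (alpha_gt i)) Lp.
by apply: psd_eq Lp => z w; rewrite /polydisc_kernel [in RHS](bigD1 i).
Qed.

Lemma disc_multipliers : exists M : forall i, adjop (A i),
  forall i u z, (M i u) z = val z * u z.
Proof.
suff MP i : exists M : adjop (A i), forall u z, (M u) z = val z * u z.
  by exists (fun i => projT1 (cid (MP i))) => i; case: (cid (MP i)).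
have [|M [_ ME]] := contractive_multiplier (AK i) (c := fun z => val z).
  apply: psd_eq (psd_disc_kernel_sub id (alpha_gt i) (@psd_const1 _ _)) => z w.
  by rewrite mulr1.
by exists M.
Qed.

(** Replacing the factors one at a time, the defect of positivity of
    [prod |F_i|^2 K_i - prod F_i (conj F_i)] is a sum of kernels of the form
    [prod |F_i|^2 K_i (|F_j|^2 K_j - F_j (conj F_j)) prod F_i (conj F_i)]. *)
Lemma pure_tensor_member F : exists u : hsp H,
  hfun u = pure_tensor F /\ nrm u <= \prod_(i < n) nrm (F i).
Proof.
apply: (psd_member HK); first by rewrite prodr_ge0 // => i _; apply: nrm_ge0.
rewrite /pure_tensor /polydisc_kernel; elim: (index_enum _) => [|i s IH].
  apply: psd_eq (psdZ (lexx 0) (@psd_const1 _ _)) => z w.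
  by rewrite !big_nil expr1n conjC1 !mulr1 rmorph1 subrr.
have nn : 0 <= real_complex R (nrm (F i) ^+ 2) by rewrite ler0c sqr_ge0.
have p1 := psdZ nn (psd_disc_kernel (fun z : polydisc R n => z i) (alpha_gt i) IH).
have p2 := psd_conj (fun z => \prod_(j <- s) F j (z j))
  (psd_comp (fun z : polydisc R n => z i) (member_psd (AK i) (F i))).
apply: psd_eq (psdD p1 p2) => z w.
rewrite !big_cons exprMn !rmorphM /=; ring.
Qed.

Fact pure_tensor_carrier F : carrier H (pure_tensor F).
Proof. by have [u [<- _]] := pure_tensor_member F; apply: hfunP. Qed.

Definition ptensor F : hsp H := Hsp (pure_tensor_carrier F).

Lemma ptensorE F z : ptensor F z = \prod_(i < n) F i (z i).
Proof. by []. Qed.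

Lemma nrm_ptensor F : nrm (ptensor F) <= \prod_(i < n) nrm (F i).
Proof.
have [u [uF ub]] := pure_tensor_member F.
by rewrite (_ : ptensor F = u) //; apply: hfun_inj.
Qed.

Lemma dfwith_id F a : put F (F a) = F.
Proof. by apply: functional_extensionality_dep => i; case: eqtype.dfwithP. Qed.

Lemma prod_dfwith (S : comPzSemiRingType) F a (g : hsp (A a))
    (h : forall i, hsp (A i) -> S) :
  \prod_(i < n) h i (put F g i) = h a g * \prod_(i < n | i != a) h i (F i).
Proof.
rewrite (bigD1 a) //= dfwith_in; congr (_ * _).
by apply: eq_bigr => i ia; rewrite dfwith_out // eq_sym.
Qed.

Lemma ptensor_dfwith F a (g : hsp (A a)) z :
  ptensor (put F g) z = g (z a) * \prod_(i < n | i != a) F i (z i).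
Proof. exact: (prod_dfwith F g (fun i u => u (z i))). Qed.

Lemma ptensor_dfwith_lin F a c (g h : hsp (A a)) :
  ptensor (put F (c *: g + h)) = c *: ptensor (put F g) + ptensor (put F h).
Proof.
by apply: hspP => z; rewrite !(hspD, hspZ, ptensor_dfwith) mulrDl mulrA.
Qed.

Lemma slot_adjoint F a : exists T : hsp H -> hsp (A a),
  forall v g, ip (ptensor (put F g)) v = ip g (T v).
Proof.
apply: (@bounded_adjoint _ _ _ (A a) H (fun g => ptensor (put F g))
  (\prod_(i < n | i != a) nrm (F i))).
- by rewrite prodr_ge0 // => i _; apply: nrm_ge0.
- by move=> c g h; apply: ptensor_dfwith_lin.
- move=> g; apply: le_trans (nrm_ptensor _) _.
  by rewrite (prod_dfwith F g (fun i u => nrm u)) mulrC.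
Qed.

Lemma kerf_ptensor w : kerf HK w = ptensor (fun i => kerf (AK i) (w i)).
Proof. exact: hspP. Qed.

Section Span.
Variable q : forall i, hsp (A i) -> Prop.

Definition tspan (u : hsp H) : Prop := tensor_span (fun i => funs (@q i)) u.

Lemma tspan_linear : hlinear tspan.
Proof.
split; first by exists 0%N, (fun=> 0), (fun _ _ => 0); split=> [[]//|];
  apply/funext => z; rewrite big_ord0.
move=> a u v [k [c [F [Fq uE]]]] [k' [c' [F' [F'q vE]]]].
exists (k + k')%N, (fun i => match fintype.split i with inl j => a * c j | inr j => c' j end),
  (fun i => match fintype.split i with inl j => F j | inr j => F' j end); split.
  by move=> i; case: (fintype.split i).
apply/funext => z; rewrite hspD hspZ uE vE big_split_ord /= mulr_sumr.
congr (_ + _); apply: eq_bigr => j _.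
  by rewrite (unsplitK (inl j) : fintype.split (lshift k' j) = inl j) mulrA.
by rewrite (unsplitK (inr j) : fintype.split (rshift k j) = inr j).
Qed.

Lemma tspan_ptensor F : (forall i, q (F i)) -> tspan (ptensor F).
Proof.
move=> Fq; exists 1%N, (fun=> 1), (fun _ i => F i); split.
  by move=> _ i; apply/funsP.
by apply/funext => z; rewrite big_ord1 mul1r.
Qed.

Lemma tspan_ind (V : hsp H -> Prop) : hlinear V ->
  (forall F, (forall i, q (F i)) -> V (ptensor F)) -> forall u, tspan u -> V u.
Proof.
move=> [V0 Vlin] VF u [k [c [F [Fq uE]]]].
have cF j i : carrier (A i) (F j i) by have [f [-> _]] := Fq j i; apply: hfunP.
pose G j : vecs := fun i => Hsp (cF j i).
have Gq j i : q (G j i) by apply/funsP; apply: Fq.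
have -> : u = \sum_(j < k) c j *: ptensor (G j).
  by apply: hspP => z; rewrite uE hsp_sum; apply: eq_bigr => j _; rewrite hspZ.
elim/big_rec: _ => // j v _ Vv; apply: Vlin => //; exact: VF.
Qed.

Lemma perp_tspan v : perp tspan v <-> forall F, (forall i, q (F i)) -> ip v (ptensor F) = 0.
Proof.
split=> [vt F Fq|vF u tu]; first exact/vt/tspan_ptensor.
have : perp (eq v) u; last first.
  by move=> /(_ v erefl) uv; rewrite ipC uv conjC0.
apply: (tspan_ind _ _ tu); first exact: perp_linear.
by move=> F Fq _ <-; rewrite ipC vF // conjC0.
Qed.

Lemma hilbert_tensor_funs :
  hilbert_tensor H (fun i => funs (@q i)) = funs (adherent tspan).
Proof. exact: hclosure_funs. Qed.

End Span.
End Tensors.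

(** * Tensor factors of a quotient module with product kernel *)

Section Forward.
Variables (R : realType) (n : nat) (alpha : 'I_n -> int).
Variables (H : hilbert_fun_space R (polydisc R n)).
Variable A : 'I_n -> hilbert_fun_space R (disc R).
Hypothesis n_gt0 : (0 < n)%N.
Hypothesis alpha_gt : forall i, -1 < alpha i.
Hypothesis HK : reproducing_kernel H (polydisc_kernel alpha).
Hypothesis AK : forall i, reproducing_kernel (A i) (disc_kernel (alpha i)).
Variable M : 'I_n -> adjop H.
Hypothesis ME : forall i u z, (M i u) z = val (z i) * u z.
Variable MA : forall i, adjop (A i).
Hypothesis MAE : forall i u z, (MA i u) z = val z * u z.
Variables (q : hsp H -> Prop) (P : adjop H).
Hypotheses (sP : star P = P) (PP : P * P = P) (Pq : forall u, q u <-> P u = u).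
Hypothesis perp_inv : forall i u, perp q u -> perp q (M i u).

Local Notation put := eqtype.dfwith.
Local Notation pt := (@ptensor R n alpha H A alpha_gt HK AK).
Local Notation k := (kerf HK).
Local Notation o := (fun _ : 'I_n => disc0 R).

Definition axis i (x : disc R) : polydisc R n :=
  @eqtype.dfwith _ (fun=> disc R) o i x.

Lemma axis_in i x : axis i x i = x.
Proof. exact: eqtype.dfwith_in. Qed.

Lemma axis_out i x j : j != i -> axis i x j = disc0 R.
Proof. by move=> ji; rewrite /axis eqtype.dfwith_out // eq_sym. Qed.

Lemma perp_kerf u : perp q u <-> forall w, ip u (P (k w)) = 0.
Proof.
rewrite (projection_perp sP PP Pq).
split=> [Pu w|uP]; first by rewrite -{1}sP -starP Pu ip0l.
by apply: (@kerf_total _ _ _ _ HK) => w; rewrite starP sP.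
Qed.

(** The constant [1] is the kernel function of the origin. *)
Let unit_vec : forall i, hsp (A i) := fun i => kerf (AK i) (disc0 R).
Definition embed i (g : hsp (A i)) : hsp H := pt (put unit_vec g).

(** The [i]-th factor is found through its complement: the functions of [z_i]
    alone that lie in the submodule. *)
Definition slot_submodule i (g : hsp (A i)) : Prop := perp q (embed g).
Definition slot_quotient i : hsp (A i) -> Prop := perp (@slot_submodule i).

Lemma embed_adjoint i : exists J : hsp H -> hsp (A i),
  forall v g, ip (embed g) v = ip g (J v).
Proof. exact: slot_adjoint. Qed.

Lemma slot_submodule_perp i : exists S : hsp (A i) -> Prop,
  forall g, slot_submodule g <-> perp S g.
Proof.
have [J JP] := embed_adjoint i; exists (fun g => exists v, q v /\ g = J v) => g.
split=> [gq _ [v [qv ->]]|gS v qv]; first by rewrite -JP gq.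
by rewrite JP; apply: gS; exists v.
Qed.

Lemma slot_biperp i g : perp (@slot_quotient i) g -> slot_submodule g.
Proof.
have [S SP] := slot_submodule_perp i; move=> gS.
by apply/SP/perp_biperp => v vS; apply: gS => w /SP ws; apply: vS.
Qed.

Lemma embed_mul i g : embed (MA i g) = M i (embed g).
Proof. by apply: hspP => z; rewrite ME !ptensor_dfwith MAE mulrA. Qed.

Lemma slot_quotient_module i :
  quotient_module (A i) (@disc_coord R) (funs (@slot_quotient i)).
Proof.
have cl : closed_subspace (A i) (funs (@slot_quotient i)).
  apply/closed_funsP; split; first exact: perp_linear.
  by move=> u; apply: perp_biperp.
split=> //; rewrite orthocomplement_funs; split.
  apply/closed_funsP; split; first exact: perp_linear.
  by move=> u; apply: perp_biperp.
move=> [] _ [u [-> /slot_biperp uS]]; exists (MA i u); split.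
  by apply/funext => z; rewrite MAE.
move=> v vS; rewrite ipC vS ?conjC0 //.
by rewrite /slot_submodule embed_mul; apply: perp_inv.
Qed.

Section Factorized.
Hypothesis Pk_neq0 : (P (k o)) o != 0.
Variable mu : 'I_n -> R[i] -> R[i] -> R[i].
Hypothesis muP : forall z w,
  (P (k w)) z = \prod_(i < n) mu i (val (z i)) (val (w i)).

Lemma mu00_neq0 i : mu i 0 0 != 0.
Proof.
by move: Pk_neq0; rewrite muP => /prodf_neq0/(_ i isT).
Qed.

Lemma embed_kerf i x : embed (kerf (AK i) x) = k (axis i x).
Proof.
rewrite (kerf_ptensor alpha_gt HK AK); congr (pt _).
apply: functional_extensionality_dep => j.
have [->|ji] := eqVneq j i; first by rewrite eqtype.dfwith_in axis_in.
by rewrite eqtype.dfwith_out ?axis_out // eq_sym.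
Qed.

(** Restricting [P k_w] to the [i]-th axis gives a multiple of [mu_i(., w_i)], so
    these functions are, up to nonzero constants, the kernel functions of the
    factors. *)
Lemma slot_kernels : exists g : forall i, disc R -> hsp (A i),
  [/\ forall i y, slot_quotient (g i y),
      forall w, P (k w) = pt (fun i => g i (w i)) &
      forall i f, (forall y, ip f (g i y) = 0) -> slot_submodule f].
Proof.
have [J JP] : exists J : forall i, hsp H -> hsp (A i),
    forall i v g, ip (embed g) v = ip g (J i v).
  exists (fun i => projT1 (cid (embed_adjoint i))) => i.
  by case: (cid (embed_adjoint i)).
have Jx i w x : (J i (P (k w))) x =
    mu i (val x) (val (w i)) * \prod_(j < n | j != i) mu j 0 (val (w j)).
  rewrite (evalE (AK i)) ipC -JP embed_kerf -ipC -evalE muP.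
  rewrite (bigD1 i) //= axis_in; congr (_ * _).
  by apply: eq_bigr => j ji; rewrite axis_out.
pose c i := \prod_(j < n | j != i) mu j 0 0.
have c0 i : c i != 0 by apply/prodf_neq0 => j _; apply: mu00_neq0.
pose g i y := (c i)^-1 *: J i (P (k (axis i y))).
have gx i y x : (g i y) x = mu i (val x) (val y).
  have cE : \prod_(j < n | j != i) mu j 0 (val (axis i y j)) = c i.
    by apply: eq_bigr => j ji; rewrite axis_out.
  by rewrite hspZ Jx axis_in cE mulrC mulfK.
have Jg i w : J i (P (k w)) = (\prod_(j < n | j != i) mu j 0 (val (w j))) *: g i (w i).
  by apply: hspP => x; rewrite hspZ Jx gx mulrC.
exists g; split.
- move=> i y f fS; rewrite ipZl ipC -JP fS ?conjC0 ?mulr0 //.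
  exact: projection_in.
- by move=> w; apply: hspP => z; rewrite muP; apply: eq_bigr => i _; rewrite gx.
- move=> i f fg; apply/perp_kerf => w.
  by rewrite JP Jg ipZr fg mulr0.
Qed.

(** The factors are replaced one slot at a time, starting from the tensors of
    kernel functions [g i y], which are the [P k_w]. *)
Lemma ptensor_slot_quotient F : (forall i, slot_quotient (F i)) -> q (pt F).
Proof.
move=> Fq; have [g [gq Pkg gS]] := slot_kernels.
suff : forall s : seq 'I_n, forall F : forall i, hsp (A i),
    (forall i, slot_quotient (F i)) ->
    (forall i, i \notin s -> exists y, F i = g i y) -> q (pt F).
  by move=> /(_ (enum 'I_n) F Fq); apply=> i; rewrite mem_enum.
elim=> [|a s IH] {Fq}F Fq Fg.
  have /choice[y yP] i : exists y, F i = g i y by apply: Fg.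
  have -> : F = (fun i => g i (y i)) by apply: functional_extensionality_dep.
  by rewrite -Pkg; apply: projection_in.
apply/Pq; rewrite -[RHS](subrK (P (pt F))) -[LHS]add0r; congr (_ + _).
apply/esym/ip_eq0; set v := _ - _.
have vq : perp q v.
  by apply/(projection_perp sP PP Pq); rewrite aop_sub -aopM PP subrr.
rewrite {1}/v ipBl [ip (P _) v]ipC vq ?conjC0 ?subr0; last exact: projection_in.
have [T TP] := slot_adjoint alpha_gt HK AK F a.
rewrite -[F](dfwith_id F a) TP.
apply: (Fq); apply: gS => y; rewrite ipC -TP ipC vq ?conjCK //.
apply: IH => i; first by case: eqtype.dfwithP => [|j _]; [apply: gq|apply: Fq].
case: eqtype.dfwithP => [_|j ja js]; first by exists y.
by apply: Fg; rewrite inE eq_sym (negPf ja).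
Qed.

End Factorized.

Lemma hilbert_tensor_slot_quotients :
  (forall F, (forall i, slot_quotient (F i)) -> q (pt F)) ->
  (forall w, P (k w) = 0 \/ tspan (@slot_quotient) (P (k w))) ->
  funs q = hilbert_tensor H (fun i => funs (@slot_quotient i)).
Proof.
move=> ptq Pkt; rewrite hilbert_tensor_funs; congr funs.
apply/funext => u; apply/propext; split=> [qu|ut].
  apply: biperp_adherent; first exact: tspan_linear.
  move=> v vt; have vq : perp q v.
    apply/perp_kerf => w; have [->|Pk] := Pkt w; first exact: ip0r.
    exact: vt.
  by rewrite ipC vq // conjC0.
apply/Pq/subr0_eq/ip_eq0; set v := _ - _.
have vq : perp q v.
  apply/(projection_perp sP PP Pq).
  by rewrite aop_sub -aopM PP subrr.
have vt : perp (tspan (@slot_quotient)) v.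
  apply/(perp_tspan alpha_gt HK AK) => F Fq.
  exact/vq/ptq.
rewrite {1}/v ipBl (adherent_biperp ut) //.
by rewrite ipC vq ?conjC0 ?subrr //; apply: projection_in.
Qed.

Lemma factors_of_factorization :
  (forall w, P (k w) = 0) \/ ((P (k o)) o != 0 /\
   exists mu : 'I_n -> R[i] -> R[i] -> R[i],
   forall z w, (P (k w)) z = \prod_(i < n) mu i (val (z i)) (val (w i))) ->
  funs q = hilbert_tensor H (fun i => funs (@slot_quotient i)).
Proof.
move=> [P0|[Pk_neq0 [mu muP]]]; apply: hilbert_tensor_slot_quotients.
- move=> F Fq; pose i := Ordinal n_gt0.
  have all_slot g : @slot_submodule i g by apply/perp_kerf => w; rewrite P0 ip0r.
  have F0 : F i = 0 by apply/ip_eq0/Fq/all_slot.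
  rewrite (_ : pt F = 0); first by apply/Pq; rewrite aop_0.
  by apply: hspP => z; rewrite ptensorE (bigD1 i) //= F0 mul0r.
- by move=> w; left; apply: P0.
- exact: ptensor_slot_quotient Pk_neq0 _ muP.
- move=> w; right; have [g [gq -> _]] := slot_kernels Pk_neq0 muP.
  by apply: tspan_ptensor.
Qed.

End Forward.

(** * Tensor products are doubly commuting *)

Section Backward.
Variables (R : realType) (n : nat) (alpha : 'I_n -> int).
Variables (H : hilbert_fun_space R (polydisc R n)).
Variable A : 'I_n -> hilbert_fun_space R (disc R).
Hypothesis alpha_gt : forall i, -1 < alpha i.
Hypothesis HK : reproducing_kernel H (polydisc_kernel alpha).
Hypothesis AK : forall i, reproducing_kernel (A i) (disc_kernel (alpha i)).

Local Notation put := eqtype.dfwith.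
Local Notation pt := (@ptensor R n alpha H A alpha_gt HK AK).
Local Notation vecs := (forall i, hsp (A i)).
Implicit Types F G : vecs.

(** Both sides are bounded and antilinear in each factor of the second tensor,
    and they agree on kernel functions by the reproducing property. *)
Lemma ip_ptensor F G : ip (pt F) (pt G) = \prod_(i < n) ip (F i) (G i).
Proof.
suff : forall s : seq 'I_n, forall G : vecs,
    (forall i, i \notin s -> exists y, G i = kerf (AK i) y) ->
    ip (pt F) (pt G) = \prod_(i < n) ip (F i) (G i).
  by move=> /(_ (enum 'I_n) G); apply=> i; rewrite mem_enum.
elim=> [|a s IH] {}G Gk.
  have /choice[y yP] i : exists y, G i = kerf (AK i) y by apply: Gk.
  have -> : G = (fun i => kerf (AK i) (y i)) by apply: functional_extensionality_dep.
  rewrite -(kerf_ptensor alpha_gt HK AK) -(evalE HK) ptensorE.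
  by apply: eq_bigr => i _; rewrite -(evalE (AK i)).
have [T TP] := slot_adjoint alpha_gt HK AK G a.
pose c := \prod_(i < n | i != a) ip (F i) (G i).
have Tc : T (pt F) = c *: F a.
  apply: hspP => x; rewrite (evalE (AK a)) ipC -TP -ipC IH.
    rewrite (prod_dfwith G _ (fun i g => ip (F i) g)) hspZ (evalE (AK a)) mulrC //.
  move=> i; case: eqtype.dfwithP => [_|j ja js]; first by exists x.
  by apply: Gk; rewrite inE eq_sym (negPf ja).
rewrite -{1}[G](dfwith_id G a) ipC TP -ipC Tc ipZl mulrC.
by rewrite [RHS](bigD1 a).
Qed.

Variable M : 'I_n -> adjop H.
Hypothesis ME : forall i u z, (M i u) z = val (z i) * u z.
Variable MA : forall i, adjop (A i).
Hypothesis MAE : forall i u z, (MA i u) z = val z * u z.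

Lemma mul_ptensor i F : M i (pt F) = pt (put F (MA i (F i))).
Proof.
apply: hspP => z; rewrite ME ptensor_dfwith MAE -mulrA; congr (_ * _).
by rewrite ptensorE (bigD1 i).
Qed.

Lemma star_mul_ptensor i F : star (M i) (pt F) = pt (put F (star (MA i) (F i))).
Proof.
apply: hspP => w; rewrite !(evalE HK) starP starK.
rewrite !(kerf_ptensor alpha_gt HK AK) mul_ptensor !ip_ptensor.
rewrite (bigD1 i) //= eqtype.dfwith_in (prod_dfwith F _ (fun j g => ip g (kerf (AK j) (w j)))).
rewrite -[asop _ _]/(star (MA i) (F i)) starP starK.
congr (_ * _); apply: eq_bigr => j ji.
by rewrite eqtype.dfwith_out // eq_sym.
Qed.

Variable q : forall i, hsp (A i) -> Prop.
Variable p : forall i, adjop (A i).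
Hypotheses (sp : forall i, star (p i) = p i) (pp : forall i, p i * p i = p i).
Hypothesis pq : forall i u, @q i u <-> p i u = u.
Hypothesis perpq_inv : forall i u, perp (@q i) u -> perp (@q i) (MA i u).

Variables (Q : hsp H -> Prop) (P : adjop H).
Hypotheses (sP : star P = P) (PP : P * P = P) (PQ : forall u, Q u <-> P u = u).
Hypothesis Qt : forall u, Q u <-> adherent (tspan q) u.
Hypothesis perpQ_inv : forall i u, perp Q u -> perp Q (M i u).

Lemma ptensor_in F : (forall i, q (F i)) -> Q (pt F).
Proof.
move=> Fq; apply/Qt => e e0; exists (pt F); rewrite subrr nrm0; split=> //.
exact: tspan_ptensor.
Qed.

Lemma perp_factor i g : perp (@q i) g <-> p i g = 0.
Proof. exact: projection_perp. Qed.

Lemma compression_ptensor i F : (forall j, q (F j)) ->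
  P (M i (pt F)) = pt (put F (p i (MA i (F i)))).
Proof.
move=> Fq; rewrite mul_ptensor; set g := MA i (F i).
have {1}-> : g = 1 *: (g - p i g) + p i g by rewrite scale1r subrK.
rewrite ptensor_dfwith_lin scale1r aop_add.
have -> : P (pt (put F (g - p i g))) = 0.
  apply/(projection_perp sP PP PQ) => u /Qt/adherent_biperp ut.
  rewrite ipC ut ?conjC0 //; apply/(perp_tspan alpha_gt HK AK) => G Gq.
  rewrite ip_ptensor (bigD1 i) //= eqtype.dfwith_in.
  have : perp (@q i) (g - p i g) by apply/perp_factor; rewrite aop_sub -aopM pp subrr.
  by move=> /(_ _ (Gq i)) ->; rewrite mul0r.
rewrite add0r; apply/PQ/ptensor_in => j.
by case: eqtype.dfwithP => [|l _] //; apply/pq; rewrite -aopM pp.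
Qed.

Lemma star_mul_in i u : q u -> q (star (MA i) u).
Proof.
move=> qu; apply/pq/subr0_eq/ip_eq0; set v := _ - _.
have vq : perp (@q i) v.
  by apply/perp_factor; rewrite /v aop_sub -aopM pp subrr.
rewrite {1}/v ipBl starP sp ((perp_factor v).1 vq) ip0r sub0r starP starK.
by rewrite ipC (perpq_inv vq) // conjC0 oppr0.
Qed.

(** On pure tensors [P M_i] and [M_j^*] act on different slots.  They therefore
    commute on the span, and adjoints carry this over to its closure. *)
Lemma tensor_commute i j : i != j ->
  GRing.comm (P * M i * P) (star (P * M j * P)).
Proof.
move=> ij; have ji : j != i by rewrite eq_sym.
have PM l := projection_mul sP PP PQ (@perpQ_inv l).
have MP l : star (M l) * P = P * star (M l) * P.
  by have := congr1 (@star _ _ H) (PM l); rewrite !starM sP mulrA.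
pose Y := P * M i * star (M j) - star (M j) * P * M i.
have Yt u : tspan q u -> Y u = 0.
  move=> tu.
  apply: (@tspan_ind _ _ _ _ _ alpha_gt HK AK q (fun u => Y u = 0) _ _ u tu); first split; first exact: aop_0.
    by move=> a v w Yv Yw; rewrite aop_lin Yv Yw scaler0 addr0.
  move=> F Fq; apply/eqP; rewrite aopB !aopM subr_eq0; apply/eqP.
  rewrite star_mul_ptensor !compression_ptensor // ?star_mul_ptensor; last first.
    by move=> l; case: eqtype.dfwithP => // ; apply: star_mul_in.
  congr (pt _); apply: functional_extensionality_dep => l.
  rewrite [put F _ i]eqtype.dfwith_out // [put F _ j]eqtype.dfwith_out //.
  have [->|li] := eqVneq l i.
    by rewrite eqtype.dfwith_in eqtype.dfwith_out // eqtype.dfwith_in.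
  have [->|lj] := eqVneq l j.
    by rewrite eqtype.dfwith_in eqtype.dfwith_out // eqtype.dfwith_in.
  by rewrite !eqtype.dfwith_out // eq_sym.
have YQ u : Q u -> Y u = 0.
  move=> /Qt/adherent_biperp ut; apply: ip_injl => v; rewrite ip0l starP.
  by apply: ut => w /Yt Yw; rewrite starP starK Yw ip0r.
have YP : Y * P = 0.
  apply: adjopP => u; rewrite aopM aop0; apply: YQ.
  exact: projection_in.
have {YP} : P * M i * star (M j) * P = star (M j) * P * M i * P.
  by apply/eqP; rewrite -subr_eq0 -mulrBl; apply/eqP.
rewrite /GRing.comm !starM sP [P * (star _ * P)]mulrA -PM -MP.
rewrite !mulrA -(mulrA _ P P) PP => ->.
by rewrite -!mulrA (mulrA P) -PM.
Qed.

End Backward.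

(** * The theorem *)

Lemma polydisc_kernel_inverse (R : realType) n (alpha : 'I_n -> int)
    (alpha_gt : forall i, -1 < alpha i) (z w : polydisc R n) :
  \prod_(i < n) (1 - val (z i) * (val (w i))^*) ^+ kernel_order (alpha i) *
    polydisc_kernel alpha z w = 1.
Proof.
rewrite -big_split big1 // => i _ /=; rewrite disc_kernelE // exprVn mulfV //.
by rewrite expf_neq0 // one_sub_neq0.
Qed.

Lemma quotient_module_data (R : realType) (X I : Type) (H : hilbert_fun_space R X)
    (coord : I -> X -> R[i]) (M : I -> adjop H) (Q : set (X -> R[i])) :
  (forall i u x, (M i u) x = coord i x * u x) -> quotient_module H coord Q ->
  exists (q : hsp H -> Prop) (P : adjop H),
    [/\ Q = funs q, star P = P, P * P = P, forall u, q u <-> P u = u &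
        forall i u, perp q u -> perp q (M i u)].
Proof.
move=> ME [Qcl [_ Qinv]]; have QE : Q = funs (fun u : hsp H => Q u).
  by apply: funs_restrict; case: Qcl.
have [qlin qcl] : hlinear (fun u : hsp H => Q u) /\
    forall u : hsp H, perp (perp (fun v : hsp H => Q v)) u -> Q u.
  by apply/closed_funsP; rewrite -QE.
have [P [sP PP Pq]] := projection_exists qlin qcl.
exists (fun u : hsp H => Q u), P; split=> // i u uq; apply/funsP.
rewrite -orthocomplement_funs -QE (_ : hfun (M i u) = mulop coord i u).
  by apply: Qinv; rewrite QE orthocomplement_funs; apply/funsP.
by apply/funext => x; rewrite ME.
Qed.

Theorem theorem4p9 (R : realType) (n : nat) (alpha : 'I_n -> int)
    (H : hilbert_fun_space R (polydisc R n))
    (A : 'I_n -> hilbert_fun_space R (disc R))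
    (hn : (2 <= n)%N) (halpha : forall i, -1 < alpha i)
    (hH : polydisc_bergman alpha H)
    (hA : forall i, disc_bergman (alpha i) (A i))
    (Q : set (polydisc R n -> R[i]))
    (hQ : quotient_module H (@polydisc_coord R n) Q) :
  doubly_commuting H (@polydisc_coord R n) Q <->
  exists Qi : 'I_n -> set (disc R -> R[i]),
    (forall i, quotient_module (A i) (@disc_coord R) (Qi i)) /\
    Q = hilbert_tensor H Qi.
Proof.
have HK := hH.2.
have AK i : reproducing_kernel (A i) (disc_kernel (alpha i)) by case: (hA i).
have [M [Mc ME]] := coordinate_multipliers halpha HK.
have [MA MAE] := disc_multipliers halpha AK.
have [q [P [-> sP PP Pq perp_inv]]] := quotient_module_data (M := M) ME hQ.
have PM i := projection_mul sP PP Pq (perp_inv i).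
rewrite (doubly_commutingP sP PP Pq ME PM); split=> [dc|[Qi [Qi_mod QE]] i j ij].
  exists (fun i => funs (@slot_quotient _ _ _ _ _ halpha HK AK q i)); split.
    by move=> i; exact (slot_quotient_module halpha HK AK ME MAE perp_inv i).
  apply: (factors_of_factorization _ halpha AK sP PP Pq); first exact: ltnW.
  exact (kernel_factorization HK (o := fun _ => disc0 R)
    (fun i z => disc_lt1 (z i)) (fun _ => erefl) (polydisc_kernel_inverse halpha)
    Mc ME sP PP PM dc).
have data l := quotient_module_data (M := fun _ : unit => MA l)
  (fun _ => MAE l) (Qi_mod l).
pose qi l := projT1 (cid (data l)).
pose p l := projT1 (cid (projT2 (cid (data l)))).
have pP l : [/\ Qi l = funs (qi l), star (p l) = p l, p l * p l = p l,
    forall u, qi l u <-> p l u = u &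
    forall (_ : unit) u, perp (qi l) u -> perp (qi l) (MA l u)].
  exact: projT2 (cid (projT2 (cid (data l)))).
have {}QE : funs q = funs (adherent (tspan (H := H) qi)).
  rewrite QE (_ : Qi = fun l => funs (qi l)); first exact: hilbert_tensor_funs.
  by apply/funext => l; case: (pP l).
apply: (tensor_commute halpha HK AK ME MAE (q := qi) (p := p) _ _ _ _ sP PP Pq _ perp_inv).
- by move=> l; case: (pP l).
- by move=> l; case: (pP l).
- by move=> l; case: (pP l).
- by move=> l u; case: (pP l) => _ _ _ _; apply; exact: tt.
- by move=> u; rewrite -[q u]funsP QE funsP.
- by rewrite neq_ltn ij.
Qed.
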